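(* Let $M$ be a monoid and let $X,Y$ be (left) equivariant classifying spaces for $M$. Then $X$ and $Y$ are $M$-homotopy equivalent by a cellular $M$-homotopy equivalence.
   Context: Let $M$ be a monoid with the discrete topology. An $M$-set $P$ (set with left $M$-action) is projective if every surjective $M$-equivariant map onto $P$ has an $M$-equivariant section; equivalently $P\cong\coprod_{a\in A}Me_a$ with each $e_a\in M$ idempotent. An $M$-space is a topological space with a continuous left action of $M$; $M$-sets are regarded as discrete $M$-spaces. $I=[0,1]$, $B^n$ and $S^{n-1}=\partial B^n$ carry trivial $M$-actions. A projective $M$-CW complex is an $M$-space $X=\varinjlim X_n$ (along inclusions) where $X_0=P_0$ is a projective $M$-set and, for $n\ge1$, $X_n$ is a pushout of $M$-spaces $X_n=X_{n-1}\cup_{P_n\times S^{n-1}}(P_n\times B^n)$ along an $M$-equivariant continuous map $P_n\times S^{n-1}\to X_{n-1}$, with $P_n$ a projective $M$-set. It is in particular a CW complex with $n$-skeleton $X_n$; a map is cellular if it preserves $n$-skeleta for all $n$. A (left) equivariant classifying space for $M$ is a projective $M$-CW complex that is contractible (as a topological space). An $M$-homotopy between $M$-equivariant continuous maps $f,g\colon X\to Y$ is an $M$-equivariant continuous map $H\colon X\times I\to Y$ with $H(x,0)=f(x)$ and $H(x,1)=g(x)$; write $f\simeq_M g$. An $M$-equivariant continuous map $f\colon X\to Y$ is an $M$-homotopy equivalence if there is an $M$-equivariant continuous $g\colon Y\to X$ with $gf\simeq_M1_X$ and $fg\simeq_M1_Y$. *)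

(* Defs.v *)
From HB Require Import structures.
From mathcomp Require Import all_boot all_order all_algebra.
From mathcomp Require Import all_classical all_reals.
From mathcomp Require Import topology normedtype.

Set Implicit Arguments.
Unset Strict Implicit.
Unset Printing Implicit Defensive.

Import Order.TTheory GRing.Theory Num.Theory.
Import numFieldNormedType.Exports.

Local Open Scope classical_set_scope.
Local Open Scope ring_scope.

Section Actions.
Variable M : monoidType.

Definition left_action (T : Type) (act : M -> T -> T) : Prop :=
  (forall x, act 1%g x = x) /\
  (forall a b x, act (a * b)%g x = act a (act b x)).

Record mset := MSet {
  mset_carrier :> choiceType;
  msetact : M -> mset_carrier -> mset_carrier;
  msetactP : left_action msetact }.

Definition mset_map (P Q : mset) (f : P -> Q) : Prop :=
  forall a x, f (msetact a x) = msetact a (f x).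

Definition projective_mset (P : mset) : Prop :=
  forall (Q : mset) (p : Q -> P), mset_map p -> (forall x, exists y, p y = x) ->
    exists s : P -> Q, mset_map s /\ forall x, p (s x) = x.

(* [M] carries the discrete topology. *)
Definition continuous_action (T : topologicalType) (act : M -> T -> T) : Prop :=
  continuous (fun z : (discrete_topology M * T)%type => act z.1 z.2).

Record mspace := MSpace {
  mspace_carrier :> topologicalType;
  mact : M -> mspace_carrier -> mspace_carrier;
  mactP : left_action mact;
  mact_continuous : continuous_action mact }.

Definition mspace_map (X Y : mspace) (f : X -> Y) : Prop :=
  continuous f /\ forall a x, f (mact a x) = mact a (f x).

Definition mspace_iso (X Y : mspace) (f : X -> Y) : Prop :=
  mspace_map f /\
  exists g : Y -> X, [/\ mspace_map g, cancel f g & cancel g f].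

Lemma continuous_actionP (T : topologicalType) (act : M -> T -> T) :
  (forall a, continuous (act a)) -> continuous_action act.
Proof.
move=> act_cont [a x] U /= nU.
exists ([set a], act a @^-1` U); last by move=> [b y] /= [-> Uy].
by split; [exact/principal_filterP | exact: (act_cont a x)].
Qed.

Lemma mact_cont (X : mspace) a : continuous (@mact X a).
Proof.
move=> x U nU.
have [[A B] /= [Aa Bx] AB] := @mact_continuous X (a, x) U nU.
by apply: filterS Bx => y By; apply: (AB (a, y)); split=> //; exact/principal_filterP.
Qed.

Section Discrete.
Variable P : mset.

Definition discrete_act (a : M) (x : discrete_topology P) : discrete_topology P := msetact a x.

Lemma discrete_mspace_actP : left_action discrete_act.
Proof. exact: msetactP. Qed.

Lemma discrete_mspace_continuous : continuous_action discrete_act.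
Proof.
apply: continuous_actionP => a x U /principal_filterP Ux.
exact/principal_filterP.
Qed.

Definition discrete_mspace : mspace :=
  MSpace discrete_mspace_actP discrete_mspace_continuous.
End Discrete.

Section Trivial.
Variable T : topologicalType.

Definition trivial_act (a : M) (x : T) : T := x.

Lemma trivial_mspace_actP : left_action trivial_act.
Proof. by []. Qed.

Lemma trivial_mspace_continuous : continuous_action trivial_act.
Proof. by apply: continuous_actionP => a x; exact: cvg_id. Qed.

Definition trivial_mspace : mspace :=
  MSpace trivial_mspace_actP trivial_mspace_continuous.
End Trivial.

Section Product.
Variables X Y : mspace.

Definition prod_act (a : M) (z : (X * Y)%type) : (X * Y)%type := (mact a z.1, mact a z.2).

Lemma prod_mspace_actP : left_action prod_act.
Proof.
have [X1 XM] := @mactP X; have [Y1 YM] := @mactP Y.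
by split=> [[x y] | a b [x y]]; rewrite /prod_act /= ?X1 ?Y1 ?XM ?YM.
Qed.

Lemma prod_mspace_continuous : continuous_action prod_act.
Proof.
apply: continuous_actionP => a [x y] U [[A B] /= [nA nB] AB].
exists (mact a @^-1` A, mact a @^-1` B).
  by split; [exact: (@mact_cont X a x) | exact: (@mact_cont Y a y)].
by move=> [u v] [/= Au Bv]; exact: AB.
Qed.

Definition prod_mspace : mspace :=
  MSpace prod_mspace_actP prod_mspace_continuous.
End Product.

(* The square  A --f--> B
               |g       |h
               C --k--> D   is a pushout in the category of M-spaces. *)
Definition mspace_pushout (A B C D : mspace)
    (f : A -> B) (g : A -> C) (h : B -> D) (k : C -> D) : Prop :=
  [/\ [/\ mspace_map f, mspace_map g, mspace_map h & mspace_map k],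
      forall x, h (f x) = k (g x)
    & forall (Z : mspace) (u : B -> Z) (v : C -> Z),
        mspace_map u -> mspace_map v -> (forall x, u (f x) = v (g x)) ->
        exists! w : D -> Z,
          [/\ mspace_map w, forall b, w (h b) = u b & forall c, w (k c) = v c]].

(* [X] is the colimit of [Xs 0 -> Xs 1 -> ...] in the category of M-spaces. *)
Definition mspace_seq_colimit (Xs : nat -> mspace)
    (i : forall n, Xs n -> Xs n.+1) (X : mspace) (j : forall n, Xs n -> X) :
    Prop :=
  [/\ forall n, mspace_map (i n) /\ mspace_map (j n),
      forall n x, j n.+1 (i n x) = j n x
    & forall (Z : mspace) (u : forall n, Xs n -> Z),
        (forall n, mspace_map (u n)) -> (forall n x, u n.+1 (i n x) = u n x) ->
        exists! w : X -> Z, mspace_map w /\ forall n x, w (j n x) = u n x].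

End Actions.

Section Homotopy.
Variable R : realType.

Definition unit_interval : topologicalType :=
  Topological.clone (set_type (`[0%R, 1%R]%classic : set R)) _.

Lemma unit_interval0_subproof : (0 : R) \in (`[0%R, 1%R]%classic : set R).
Proof. by apply/mem_set; rewrite /= in_itv /= lexx ler01. Qed.

Lemma unit_interval1_subproof : (1 : R) \in (`[0%R, 1%R]%classic : set R).
Proof. by apply/mem_set; rewrite /= in_itv /= lexx ler01. Qed.

Definition I0 : unit_interval := exist _ 0 unit_interval0_subproof.
Definition I1 : unit_interval := exist _ 1 unit_interval1_subproof.

Definition contractible (T : topologicalType) : Prop :=
  exists (c : T) (H : (T * unit_interval)%type -> T),
    [/\ continuous H, forall x, H (x, I0) = x & forall x, H (x, I1) = c].

Definition mhomotopic (M : monoidType) (X Y : mspace M) (f g : X -> Y) : Prop :=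
  exists H : prod_mspace X (trivial_mspace M unit_interval) -> Y,
    [/\ mspace_map H, forall x, H (x, I0) = f x & forall x, H (x, I1) = g x].

Definition mhomotopy_equivalence (M : monoidType) (X Y : mspace M)
    (f : X -> Y) : Prop :=
  mspace_map f /\
  exists g : Y -> X,
    [/\ mspace_map g, mhomotopic (g \o f) idfun & mhomotopic (f \o g) idfun].

Section Disks.
Variable n : nat.

(* The norm on ['rV[R]_n] of the library is the sup norm, hence the explicit
   squared Euclidean norm; the topology is the same. *)
Definition sqnorm (x : 'rV[R]_n) : R := \sum_i x 0 i ^+ 2.

Definition disk_set : set 'rV[R]_n := [set x | sqnorm x <= 1].

Definition sphere_set : set 'rV[R]_n := [set x | sqnorm x = 1].

Definition disk : topologicalType := Topological.clone (set_type disk_set) _.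

(* [sphere] is the unit sphere of R^n, i.e. it has dimension n - 1. *)
Definition sphere : topologicalType :=
  Topological.clone (set_type sphere_set) _.

Lemma sphere_disk_subproof (x : sphere) : set_val x \in disk_set.
Proof. by apply/mem_set; rewrite /disk_set /= (set_valP x). Qed.

Definition sphere_disk (x : sphere) : disk :=
  exist _ (set_val x) (sphere_disk_subproof x).
End Disks.

Section CW.
Variable M : monoidType.

(* [mcw_cells n] is the M-set of n-cells; [mcw_attach n] and [mcw_char n] attach
   the (n+1)-cells to the n-skeleton. *)
Record projective_mcw := ProjectiveMCW {
  mcw_space :> mspace M;
  mcw_skel : nat -> mspace M;
  mcw_incl : forall n, mcw_skel n -> mcw_skel n.+1;
  mcw_skel_in : forall n, mcw_skel n -> mcw_space;
  mcw_cells : nat -> mset M;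
  mcw_char0 : discrete_mspace (mcw_cells 0) -> mcw_skel 0;
  mcw_attach : forall n,
    prod_mspace (discrete_mspace (mcw_cells n.+1))
                (trivial_mspace M (sphere n.+1)) -> mcw_skel n;
  mcw_char : forall n,
    prod_mspace (discrete_mspace (mcw_cells n.+1))
                (trivial_mspace M (disk n.+1)) -> mcw_skel n.+1;
  mcw_projective : forall n, projective_mset (mcw_cells n);
  mcw_skel0 : mspace_iso mcw_char0;
  mcw_pushout : forall n,
    mspace_pushout
      (A := prod_mspace (discrete_mspace (mcw_cells n.+1))
                        (trivial_mspace M (sphere n.+1)))
      (C := prod_mspace (discrete_mspace (mcw_cells n.+1))
                        (trivial_mspace M (disk n.+1)))
      (@mcw_attach n) (fun z => (z.1, sphere_disk z.2))
      (@mcw_incl n) (@mcw_char n);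
  mcw_colimit : mspace_seq_colimit mcw_incl mcw_skel_in }.

Definition skeleton (X : projective_mcw) (n : nat) : set X :=
  range (@mcw_skel_in X n).
Arguments skeleton : clear implicits.

Definition cellular (X Y : projective_mcw) (f : X -> Y) : Prop :=
  forall n, f @` skeleton X n `<=` skeleton Y n.

Definition equivariant_classifying_space (X : projective_mcw) : Prop :=
  contractible X.
End CW.

End Homotopy.

(* Main.v *)
Require Import Defs.
From HB Require Import structures.
From mathcomp Require Import all_boot all_order all_algebra.
From mathcomp Require Import all_classical all_reals topology normedtype.
From mathcomp Require Import realfun.
From mathcomp Require Import ring lra zify.

(** The theorem rests on one lifting principle, [complex_lift].  Let [p : E -> B] be a
    map of M-spaces such that, disregarding the actions, every map from a disk to [B]
    lifts to [E] with a prescribed lift on the boundary sphere.  Then every M-map from a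
    projective complex to [B] lifts to an M-map to [E].  The lift is built by induction
    over the skeleta, and equivariance is automatic: for the M-set P of cells of a given
    dimension, the pairs of a cell and a solution of its lifting problem form an M-set
    which surjects equivariantly onto P, and this surjection has a section because P is
    projective ([projective_lift]).

    Two instances give the result.

    - If [Z] is contractible, the endpoints map from the path space of [Z] to [Z * Z] has
      the lifting property ([path_lift]), because maps to [Z] extend from the boundary of a
      cylinder over a disk to its interior.  Hence any two M-maps from a projective complex
      to [Z] are M-homotopic.

    - If [Y] is a contractible complex, every map from the n-sphere to the n-skeleton of [Y]
      extends to a map from the disk to the next skeleton ([skel_sphere_extension]).  The
      lifting principle, with the skeleta of [Y] as a varying space over a point, then
      yields a cellular M-map from any projective complex to [Y].

    So there are cellular M-maps in both directions between two equivariant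
    classifying spaces, and their composites are M-homotopic to the identity maps.

    The second instance needs cellular approximation for disks.  A map from a k-disk to [Y]
    lands in some skeleton by compactness ([compact_in_stage]), and it can be pushed from
    the (m+1)-skeleton to the m-skeleton whenever m >= k, without moving the points that
    are already there ([push_off_cells]).  This amounts to avoiding the centres of the
    (m+1)-cells, and is possible since maps from a k-disk to a space of larger dimension
    are approximated by Lipschitz maps, which miss points for reasons of counting
    ([lipschitz_avoids]).

    The pushouts and colimits that define a complex are taken among M-spaces.  They are
    also pushouts and colimits of topological spaces, since the functor that forgets the
    action has a right adjoint ([cofree]); all statements on the topology of complexes
    are derived from these topological universal properties. *)

Set Implicit Arguments.
Unset Strict Implicit.
Unset Printing Implicit Defensive.

Import Order.TTheory GRing.Theory Num.Theory.
Import numFieldNormedType.Exports.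

Local Open Scope classical_set_scope.
Local Open Scope ring_scope.

(** * Elementary topology *)

Lemma comp_continuous (T U V : topologicalType) (f : T -> U) (g : U -> V) :
  continuous f -> continuous g -> continuous (fun x => g (f x)).
Proof. by move=> cf cg x; apply: continuous_comp; [exact: cf|exact: cg]. Qed.

Lemma comp_at (T U V : topologicalType) (f : T -> U) (g : U -> V) x :
  {for x, continuous f} -> {for f x, continuous g} ->
  {for x, continuous (fun y => g (f y))}.
Proof. by move=> cf cg; apply: continuous_comp. Qed.

Lemma pair_at (T U V : topologicalType) (f : T -> U) (g : T -> V) x :
  {for x, continuous f} -> {for x, continuous g} ->
  {for x, continuous (fun y => (f y, g y))}.
Proof. by move=> cf cg; apply: (@cvg_pair _ _ _ (nbhs x)). Qed.

Lemma pair_continuous (T U V : topologicalType) (f : T -> U) (g : T -> V) :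
  continuous f -> continuous g -> continuous (fun y => (f y, g y)).
Proof. by move=> cf cg x; apply: pair_at; [exact: cf|exact: cg]. Qed.

Lemma fst_continuous (T U : topologicalType) : continuous (@fst T U).
Proof. by move=> x; exact: cvg_fst. Qed.

Lemma snd_continuous (T U : topologicalType) : continuous (@snd T U).
Proof. by move=> x; exact: cvg_snd. Qed.

Lemma open_nbhsP (T : topologicalType) (O : set T) :
  (forall x, O x -> nbhs x O) -> open O.
Proof. by move=> h; rewrite openE => x /h. Qed.

Lemma preimage_open (T U : topologicalType) (f : T -> U) (O : set U) :
  continuous f -> open O -> open (f @^-1` O).
Proof. by move=> /continuousP; apply. Qed.

Lemma preimage_closedT (T U : topologicalType) (f : T -> U) (C : set U) :
  continuous f -> closed C -> closed (f @^-1` C).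
Proof. by move=> /continuous_closedP; apply. Qed.

Lemma compact_increasing_cover (T : topologicalType) (K : set T)
    (U : nat -> set T) : compact K -> (forall n, open (U n)) ->
  (forall n, U n `<=` U n.+1) -> (forall x, K x -> exists n, U n x) ->
  exists n, K `<=` U n.
Proof.
move=> /compact_near_coveringP cK oU Um cov.
have [|n _ /(_ n)] := cK nat \oo U _.
  move=> x /cov[n Unx]; exists (U n, [set m | (n <= m)%N]) => /=.
    by split; [exact: open_nbhs_nbhs | exists n].
  move=> [y m] /= [Uny nm]; elim: m nm => [|m IH].
    by rewrite leqn0 => /eqP <-.
  by rewrite leq_eqVlt => /predU1P[<-//|/IH/Um].
by move=> KU; exists n; apply: KU => /=.
Qed.

Lemma set_type_val_continuous (T : topologicalType) (A : set T) :
  continuous (fun x : set_type A => \val x).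
Proof. by rewrite -set_valE; exact: initial_continuous. Qed.

Lemma set_type_at (S T : topologicalType) (A : set T) (f : S -> set_type A) x :
  {for x, continuous (fun y => \val (f y))} -> {for x, continuous f}.
Proof.
move=> cf; rewrite /prop_for /continuous_at => W [_ [[O oO <-]] /= Ox OC].
have h : nbhs x (fun y => O (\val (f y))).
  by apply: cf; apply: open_nbhs_nbhs.
change (nbhs x (f @^-1` W)); apply: filterS h => y Oy.
by apply: OC; rewrite /= set_valE.
Qed.

Lemma set_type_continuousP (S T : topologicalType) (A : set T)
    (f : S -> set_type A) :
  continuous (fun x => \val (f x)) -> continuous f.
Proof.
move=> cf; apply/continuousP => _ [O oO <-].
by move/continuousP : cf => /(_ O oO); rewrite set_valE.
Qed.

Lemma compact_set_type (T : topologicalType) (A : set T) :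
  compact A -> compact [set: set_type A].
Proof.
move=> cA F FF _; pose v : set_type A -> T := fun x => \val x.
have vA : (v @ F) A.
  apply: (@filterS _ F _ setT); last exact: filterT.
  by move=> x _; exact: (set_valP x).
have [x [Ax clx]] := cA (v @ F) _ vA.
exists (exist _ x (mem_set Ax)); split => // B C FB [_ [[O oO <-]] /= Ox OC].
have [] := clx (v @` B) O.
- by apply: (@filterS _ F _ B _ _ FB) => y By; exists y.
- by apply: open_nbhs_nbhs; split => //; move: Ox; rewrite set_valE.
by move=> _ [[y By <-] Oy]; exists y; split => //; apply: OC; rewrite /= set_valE.
Qed.

Lemma set_type_hausdorff (T : topologicalType) (A : set T) :
  hausdorff_space T -> hausdorff_space (set_type A).
Proof.
move=> hT x y cl; apply/val_inj/hT => U V nU nV.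
have vc : continuous (fun z : set_type A => \val z) := @set_type_val_continuous _ _.
by have [z [Uz Vz]] := cl _ _ (vc x U nU) (vc y V nV); exists (\val z).
Qed.

(** * Pushouts and sequential colimits, forgetting the action *)

Lemma ptws_continuous (I : eqType) (T Z : topologicalType) (f : T -> {ptws I -> Z}) :
  (forall i, continuous (fun x => f x i)) -> continuous f.
Proof.
move=> cf x; apply/cvg_sup => i U [V [[W oW <-] Wfx] WU].
apply: (filterS WU); apply: (cf i x); exact: open_nbhs_nbhs.
Qed.

Section Cofree.
Variables (M : monoidType) (Z : topologicalType).

(** The right adjoint of the functor that forgets the action: functions on M with
    values in [Z], where M acts through right translation of the argument. *)
Definition cofree_act (a : M) (phi : {ptws M -> Z}) : {ptws M -> Z} :=
  fun m => phi (m * a)%g.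

Lemma cofree_actP : left_action cofree_act.
Proof.
split=> [phi | a b phi]; apply/funext => m; rewrite /cofree_act ?mulg1 //.
by rewrite mulgA.
Qed.

Lemma cofree_continuous : continuous_action cofree_act.
Proof.
apply: continuous_actionP => a; apply: ptws_continuous => m.
exact: (@proj_continuous M (fun=> Z) (m * a)%g).
Qed.

Definition cofree : mspace M := MSpace cofree_actP cofree_continuous.

Definition to_cofree (X : mspace M) (u : X -> Z) : X -> cofree :=
  fun x m => u (mact m x).

Lemma to_cofree_map (X : mspace M) (u : X -> Z) :
  continuous u -> mspace_map (to_cofree u).
Proof.
move=> cu; split=> [|a x].
  apply: ptws_continuous => m.
  by apply: comp_continuous cu; exact: mact_cont.
apply/funext => m; rewrite /to_cofree /= /cofree_act.
by rewrite (@mactP M X).2.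
Qed.

Lemma eval1_continuous : continuous (fun phi : cofree => phi 1%g : Z).
Proof. exact: (@proj_continuous M (fun=> Z) 1%g). Qed.

Lemma to_cofree1 (X : mspace M) (u : X -> Z) x : to_cofree u x 1%g = u x.
Proof. by rewrite /to_cofree (@mactP M X).1. Qed.
End Cofree.

Section PushoutTop.
Variables (M : monoidType) (A B C D : mspace M).
Variables (f : A -> B) (g : A -> C) (h : B -> D) (k : C -> D).
Hypothesis po : mspace_pushout f g h k.

(** Forgetting the action preserves pushouts, being a left adjoint: a continuous
    map to [Z] is the same as an M-map to [cofree M Z]. *)
Lemma pushout_top (Z : topologicalType) (u : B -> Z) (v : C -> Z) :
  continuous u -> continuous v -> (forall x, u (f x) = v (g x)) ->
  exists w : D -> Z,
    [/\ continuous w, forall b, w (h b) = u b & forall c, w (k c) = v c].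
Proof.
move=> cu cv uv; have [[[_ fM] [_ gM] _ _] _ univ] := po.
have [||x|w [[[cw _] wh wk] _]] :=
    univ (cofree M Z) (to_cofree u) (to_cofree v).
- exact: to_cofree_map.
- exact: to_cofree_map.
- by apply/funext => m; rewrite /to_cofree -fM -gM uv.
exists (fun z => w z 1%g); split=> [|b|c].
- exact: (comp_continuous cw (@eval1_continuous M Z)).
- by rewrite wh to_cofree1.
- by rewrite wk to_cofree1.
Qed.

Lemma pushout_top_uniq (Z : topologicalType) (w w' : D -> Z) :
  continuous w -> continuous w' -> (forall b, w (h b) = w' (h b)) ->
  (forall c, w (k c) = w' (k c)) -> w = w'.
Proof.
move=> cw cw' wh wk.
have [[[cf fM] [cg gM] [ch hM] [ck kM]] hfkg univ] := po.
have [||x|w0 [_ uniq]] :=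
    univ (cofree M Z) (to_cofree (w \o h)) (to_cofree (w \o k)).
- by apply: to_cofree_map; exact: comp_continuous ch cw.
- by apply: to_cofree_map; exact: comp_continuous ck cw.
- by apply/funext => m; rewrite /to_cofree /= -fM -gM hfkg.
have e1 : w0 = to_cofree w.
  apply: uniq; split; first exact: to_cofree_map.
  - by move=> b; apply/funext => m; rewrite /to_cofree /= hM.
  - by move=> b; apply/funext => m; rewrite /to_cofree /= kM.
have e2 : w0 = to_cofree w'.
  apply: uniq; split; first exact: to_cofree_map.
  - by move=> b; apply/funext => m; rewrite /to_cofree /= wh hM.
  - by move=> b; apply/funext => m; rewrite /to_cofree /= wk kM.
by apply/funext => z; rewrite -(to_cofree1 w) -e1 e2 to_cofree1.
Qed.
End PushoutTop.

Section ColimitTop.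
Variables (M : monoidType) (Xs : nat -> mspace M).
Variables (i : forall n, Xs n -> Xs n.+1) (X : mspace M) (j : forall n, Xs n -> X).
Arguments i : clear implicits.
Arguments j : clear implicits.
Hypothesis colim : mspace_seq_colimit i j.

Lemma colimit_top (Z : topologicalType) (u : forall n, Xs n -> Z) :
  (forall n, continuous (u n)) -> (forall n x, u n.+1 (i n x) = u n x) ->
  exists w : X -> Z, continuous w /\ forall n x, w (j n x) = u n x.
Proof.
move=> cu ui; have [ij _ univ] := colim.
have [|n x|w [[[cw _] wj] _]] := univ (cofree M Z) (fun n => to_cofree (u n)).
- by move=> n; exact: to_cofree_map.
- by apply/funext => m; rewrite /to_cofree -(ij n).1.2 ui.
exists (fun z => w z 1%g); split=> [|n x].
- exact: (comp_continuous cw (@eval1_continuous M Z)).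
- by rewrite wj to_cofree1.
Qed.

Lemma colimit_top_uniq (Z : topologicalType) (w w' : X -> Z) :
  continuous w -> continuous w' ->
  (forall n x, w (j n x) = w' (j n x)) -> w = w'.
Proof.
move=> cw cw' ww'; have [ij ji univ] := colim.
have [|n x|w0 [_ uniq]] := univ (cofree M Z) (fun n => to_cofree (w \o j n)).
- move=> n; apply: to_cofree_map; exact: comp_continuous (ij n).2.1 cw.
- by apply/funext => m; rewrite /to_cofree -(ij n).1.2 /= ji.
have e1 : w0 = to_cofree w.
  apply: uniq; split; first exact: to_cofree_map.
  by move=> n x; apply/funext => m; rewrite /to_cofree /= (ij n).2.2.
have e2 : w0 = to_cofree w'.
  apply: uniq; split; first exact: to_cofree_map.
  by move=> n x; apply/funext => m; rewrite /to_cofree /= ww' (ij n).2.2.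
by apply/funext => z; rewrite -(to_cofree1 w) -e1 e2 to_cofree1.
Qed.
End ColimitTop.

(** Maps to indiscrete spaces turn the topological universal properties into
    set-theoretic ones. *)
Definition indiscrete (T : Type) : Type := T.

Section Indiscrete.
Variable T : choiceType.
Let iopen : set (set T) := [set O | forall x y, O x -> O y].
Let iopenT : iopen setT. Proof. by []. Qed.
Let iopenI : setI_closed iopen.
Proof. by move=> A B oA oB x y [Ax Bx]; split; [exact: oA Ax|exact: oB Bx]. Qed.
Let iopen_bigU (I : Type) (g : I -> set T) :
  (forall i, iopen (g i)) -> iopen (\bigcup_i g i).
Proof. by move=> og x y [i _ gx]; exists i => //; exact: og gx. Qed.

HB.instance Definition _ := Choice.copy (indiscrete T) T.
HB.instance Definition _ :=
  isOpenTopological.Build (indiscrete T) iopenT iopenI iopen_bigU.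
End Indiscrete.

Lemma indiscrete_continuous (T : topologicalType) (S : choiceType)
  (f : T -> indiscrete S) : continuous f.
Proof.
apply/continuousP => O oO; have [[x Ofx]|nO] := pselect (exists x, O (f x)).
  rewrite (_ : f @^-1` O = setT); first exact: openT.
  by rewrite predeqE => y; split=> // _; exact: oO Ofx.
rewrite (_ : f @^-1` O = set0); first exact: open0.
by rewrite predeqE => x; split=> // Ox; apply: nO; exists x.
Qed.

(** The space whose only nontrivial open set is the point [true]; continuous maps to it
    correspond to open subsets, so that universal properties describe open sets. *)
Definition sierpinski : Type := bool.

Section Sierpinski.
Let sopen : set (set bool) := [set O | O false -> O true].
Let sopenT : sopen setT. Proof. by []. Qed.
Let sopenI : setI_closed sopen.
Proof. by move=> A B oA oB [Ax Bx]; split; [exact: oA Ax|exact: oB Bx]. Qed.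
Let sopen_bigU (I : Type) (g : I -> set bool) :
  (forall i, sopen (g i)) -> sopen (\bigcup_i g i).
Proof. by move=> og [i _ gx]; exists i => //; exact: og gx. Qed.

HB.instance Definition _ := Choice.copy sierpinski bool.
HB.instance Definition _ :=
  isOpenTopological.Build sierpinski sopenT sopenI sopen_bigU.
End Sierpinski.

Lemma sierpinski_continuous (T : topologicalType) (O : set T) :
  open O -> continuous (fun x => `[< O x >] : sierpinski).
Proof.
move=> oO; apply/continuousP => V oV.
have [Vf|nVf] := pselect (V false).
  rewrite (_ : _ @^-1` _ = setT); first exact: openT.
  rewrite predeqE => x; split=> //= _; case: asboolP => _ //; exact: (oV).
have [Vt|nVt] := pselect (V true); last first.
  rewrite (_ : _ @^-1` _ = set0); first exact: open0.
  by rewrite predeqE => x; split=> //=; case: asboolP.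
rewrite (_ : _ @^-1` _ = O) // predeqE => x; split=> /=.
  by case: asboolP.
by move=> Ox; rewrite asboolT.
Qed.

Lemma sierpinski_open (T : topologicalType) (w : T -> sierpinski) :
  continuous w -> open [set x | w x].
Proof. by move=> /continuousP /(_ [set x : sierpinski | x]); apply. Qed.

(** * Approximating maps from a disk by nowhere vanishing maps *)

Section Euclid.
Variable R : realType.

Lemma norm_coord n (x : 'rV[R]_n) i : `|x 0 i| <= `|x|.
Proof.
rewrite [leRHS]/Num.Def.normr /= mx_normrE; apply/bigmax_geP; right => /=.
by exists (0, i); rewrite ?mem_index_enum.
Qed.

Lemma rV_norm_le n (x : 'rV[R]_n) e :
  0 <= e -> (forall i, `|x 0 i| <= e) -> `|x| <= e.
Proof.
move=> e0 xe; rewrite [leLHS]/Num.Def.normr /= mx_normrE; apply/bigmax_leP; split => //.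
by move=> [i j] _ /=; rewrite ord1.
Qed.

Lemma sqnorm_ge0 n (x : 'rV[R]_n) : 0 <= sqnorm x.
Proof. by apply: sumr_ge0 => i _; exact: sqr_ge0. Qed.

Lemma sqnorm_coord n (x : 'rV[R]_n) i : x 0 i ^+ 2 <= sqnorm x.
Proof.
rewrite /sqnorm (bigD1 i) //= lerDl; apply: sumr_ge0 => j _; exact: sqr_ge0.
Qed.

Lemma sqnorm_eq0 n (x : 'rV[R]_n) : (sqnorm x == 0) = (x == 0).
Proof.
apply/idP/eqP => [|->]; last by rewrite /sqnorm big1 // => i _; rewrite mxE expr0n.
move=> /eqP x0; apply/rowP => i; rewrite mxE; apply/eqP.
by rewrite -sqrf_eq0 eq_le sqr_ge0 andbT -x0 sqnorm_coord.
Qed.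

Lemma sqnormZ n a (x : 'rV[R]_n) : sqnorm (a *: x) = a ^+ 2 * sqnorm x.
Proof. by rewrite /sqnorm mulr_sumr; apply: eq_bigr => i _; rewrite mxE exprMn. Qed.

Lemma sqnorm_le n (x : 'rV[R]_n) : sqnorm x <= n%:R * `|x| ^+ 2.
Proof.
rewrite mulr_natl -[X in _ *+ X]card_ord -sumr_const; apply: ler_sum => i _.
by rewrite -real_normK ?num_real // ler_sqr ?nnegrE // norm_coord.
Qed.

Lemma sqnorm_continuous n : continuous (@sqnorm R n).
Proof.
move=> x; apply: (@cvg_big _ _ _ _ _ _ _ (nbhs x)); first exact: add_continuous.
by move=> i _; apply: cvgM; exact: coord_continuous.
Qed.

Lemma disk_compact n : compact [set: disk R n].
Proof.
apply: compact_set_type; apply: bounded_closed_compact.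
  exists 1; split; [exact: num_real | move=> M M1 x /= x1].
  apply: rV_norm_le => [|i]; first by rewrite ltW // (lt_trans _ M1).
  apply: (le_trans _ (ltW M1)); rewrite -(@ler_pXn2r _ 2) ?nnegrE //.
  by rewrite expr1n real_normK ?num_real // (le_trans _ x1) ?sqnorm_coord.
have /continuous_closedP := @sqnorm_continuous n.
by move=> /(_ [set t | t <= 1]); apply; exact: closed_le.
Qed.

Lemma disk_norm n (x : disk R n) : `|\val x| <= 1.
Proof.
apply: rV_norm_le => // i; rewrite -(@ler_pXn2r _ 2) ?nnegrE //.
rewrite expr1n real_normK ?num_real //.
by rewrite (le_trans (sqnorm_coord _ _)) //; exact: (set_valP x).
Qed.

(** A form of uniform continuity.  The sets of pairs that satisfy the inequality for
    a given [L] are open, increase with [L], and cover the compact square of the disk. *)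
Lemma disk_quasi_lipschitz k m (phi : disk R k -> 'rV[R]_m) (eps : R) :
  continuous phi -> 0 < eps ->
  exists L : nat, forall x y, `|phi y - phi x| < eps + L%:R * `|\val x - \val y|.
Proof.
move=> cphi eps0.
pose U (L : nat) : set (disk R k * disk R k) :=
  [set z | `|phi z.2 - phi z.1| < eps + L%:R * `|\val z.1 - \val z.2|].
have [||||L UL] := @compact_increasing_cover _ (setT `*` setT) U.
- by apply: compact_setX; exact: disk_compact.
- move=> L; rewrite /U.
  have c1 : continuous (fun z : disk R k * disk R k => `|phi z.2 - phi z.1|).
    move=> z; apply: cvg_norm; apply: cvgB.
      by apply: continuous_comp; [exact: cvg_snd|exact: cphi].
    by apply: continuous_comp; [exact: cvg_fst|exact: cphi].
  have c2 : continuous (fun z : disk R k * disk R k =>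
      eps + L%:R * `|\val z.1 - \val z.2|).
    move=> z; apply: cvgD; first exact: cvg_cst.
    apply: cvgM; first exact: cvg_cst.
    apply: cvg_norm; apply: cvgB.
      by apply: continuous_comp; [exact: cvg_fst|exact: set_type_val_continuous].
    by apply: continuous_comp; [exact: cvg_snd|exact: set_type_val_continuous].
  pose h (z : disk R k * disk R k) : R :=
    eps + L%:R * `|\val z.1 - \val z.2| - `|phi z.2 - phi z.1|.
  rewrite (_ : mkset _ = h @^-1` [set t | 0 < t]); last first.
    by apply/seteqP; split=> z /=; rewrite /h subr_gt0.
  have /continuousP hc : continuous h by move=> z; exact: cvgB (c2 z) (c1 z).
  by apply: hc; exact: open_gt.
- move=> L z /= /lt_le_trans; apply; rewrite lerD2l ler_wpM2r //.
  by rewrite ler_nat.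
- move=> [x y] _; rewrite /U /=; have [->|xy] := eqVneq x y.
    by exists 0%N; rewrite subrr normr0 mul0r addr0.
  have d0 : 0 < `|\val x - \val y|.
    by rewrite normr_gt0 subr_eq0; apply: contra xy => /eqP/val_inj ->.
  exists (Num.truncn (`|phi y - phi x| / `|\val x - \val y|)).+1.
  rewrite -ltrBlDl (@le_lt_trans _ _ `|phi y - phi x|) ?gerBl ?ltW //.
  by rewrite -ltr_pdivrMr // truncnS_gt.
by exists L => x y; exact: (UL (x, y)).
Qed.

(** Each coordinate is regularized by a sup-convolution with [L * `|x - y|]: a supremum
    of L-Lipschitz functions is L-Lipschitz, and [disk_quasi_lipschitz] bounds its
    distance to the original function. *)
Lemma disk_lipschitz_approx k m (phi : disk R k -> 'rV[R]_m) (eps : R) :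
  continuous phi -> 0 < eps ->
  exists (L : nat) (psi : disk R k -> 'rV[R]_m),
    (forall x, `|psi x - phi x| <= eps) /\
    (forall x y, `|psi x - psi y| <= L%:R * `|\val x - \val y|).
Proof.
move=> cphi eps0; have [L phiL] := disk_quasi_lipschitz cphi eps0.
pose E (x : disk R k) j := [set phi y 0 j - L%:R * `|\val x - \val y| | y in [set: disk R k]].
have Eub x j : ubound (E x j) (phi x 0 j + eps).
  move=> _ [y _ <-]; rewrite lerBlDr -addrA -lerBlDl.
  apply: (le_trans (ler_norm _)); apply: (le_trans _ (ltW (phiL x y))).
  by have := norm_coord (phi y - phi x) j; rewrite !mxE.
have Eid x j : E x j (phi x 0 j).
  by exists x => //; rewrite subrr normr0 mulr0 subr0.
have Ene x j : E x j !=set0 by exists (phi x 0 j).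
have Ehub x j : has_ubound (E x j) by exists (phi x 0 j + eps).
exists L, (fun x => \row_j sup (E x j)); split=> [x|x y].
  apply: rV_norm_le => [|j]; first exact: ltW.
  rewrite !mxE ger0_norm ?subr_ge0; last exact: ub_le_sup.
  by rewrite lerBlDl; apply: ge_sup.
have half a b j : sup (E a j) <= sup (E b j) + L%:R * `|\val a - \val b|.
  apply: ge_sup => // _ [z _ <-].
  have : E b j (phi z 0 j - L%:R * `|\val b - \val z|) by exists z.
  move=> /(ub_le_sup (Ehub b j)) h; apply: (le_trans _ (lerD h (lexx _))).
  have : L%:R * `|\val b - \val z| <= L%:R * (`|\val b - \val a| + `|\val a - \val z|).
    by rewrite ler_wpM2l // ler_distD.
  rewrite mulrDr (distrC (\val b) (\val a)); lra.
apply: rV_norm_le => [|j]; first by rewrite mulr_ge0.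
rewrite !mxE ler_distl; apply/andP; split.
  by rewrite lerBlDr distrC; exact: half.
exact: half.
Qed.

End Euclid.

Section Avoid.
Variable R : realType.

Lemma lipschitz_continuous k m (psi : disk R k -> 'rV[R]_m) (L : nat) :
  (forall x y, `|psi x - psi y| <= L%:R * `|\val x - \val y|) ->
  continuous psi.
Proof.
move=> psiL x; apply/(@cvgrPdist_lt _ _ _ (nbhs x) (nbhs_filter x)) => e e0.
have L0 : 0 < L%:R + 1 :> R by rewrite ltr_wpDl.
have vc : (fun y : disk R k => \val y) @ (nbhs x) --> \val x.
  exact: set_type_val_continuous.
have h := @cvgr_dist_lt _ _ _ (nbhs x) (nbhs_filter x) _ _ vc _ (divr_gt0 e0 L0).
apply: filterS h => y /=; rewrite ltr_pdivlMr // => h.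
apply: (le_lt_trans (psiL _ _)); apply: le_lt_trans h.
by rewrite mulrC ler_wpM2l // lerDl.
Qed.

(** A Lipschitz image of a disk of smaller dimension cannot contain a fine grid.
    Take a grid of K^m points of mesh eta / K.  Preimages of distinct grid points are at
    distance at least a constant times 1 / K, hence lie in different boxes of a
    subdivision of the k-dimensional cube into at most (C K)^k boxes; but K^m exceeds
    (C K)^k for large K, as k < m. *)
Lemma lipschitz_avoids k m (psi : disk R k -> 'rV[R]_m) (L : nat) (eta : R) :
  (k < m)%N -> 0 < eta ->
  (forall x y, `|psi x - psi y| <= L%:R * `|\val x - \val y|) ->
  exists p, `|p| <= eta /\ forall x, psi x != p.
Proof.
move=> km eta0 psiL; apply: contrapT => nex.
(* [W] makes points in a common box have images closer than the mesh; [K] makes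
   [K ^ m] exceed the number of boxes. *)
pose W := (Num.truncn (L%:R / eta)).+1.
have LW : L%:R < W%:R * eta by rewrite -ltr_pdivrMr // truncnS_gt.
pose K := ((2 * W).+1 ^ k).+1.
have K0 : 0 < K%:R :> R by rewrite ltr0n.
pose p (c : {ffun 'I_m -> 'I_K}) : 'rV[R]_m := \row_i (eta / K%:R * (c i)%:R).
have pex c : exists x, psi x = p c.
  apply: contrapT => nx; apply: nex; exists (p c); split.
    apply: rV_norm_le => [|i]; first exact: ltW.
    rewrite mxE ger0_norm; last first.
      by rewrite mulr_ge0 // divr_ge0 // ltW.
    rewrite mulrAC ler_pdivrMr //.
    by rewrite ler_wpM2l ?ltW // ltr_nat.
  by move=> x; apply/negP => /eqP ?; apply: nx; exists x.
have [X psiX] := choice pex.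
pose N := ((2 * (K * W)).+1)%N.
have coord1 (x : disk R k) i : 0 <= (\val x 0 i + 1) * (K * W)%:R < N%:R.
  have := le_trans (norm_coord (\val x) i) (disk_norm x).
  rewrite ler_norml => /andP[h1 h2]; apply/andP; split.
    by rewrite mulr_ge0 // -lerBlDr sub0r.
  apply: (@le_lt_trans _ _ (2 * (K * W)%:R)).
    by rewrite ler_wpM2r // -[2]/(1 + 1) lerD2r.
  by rewrite -natrM ltr_nat.
have boxlt c i : (Num.truncn ((\val (X c) 0 i + 1) * (K * W)%:R)%R < N)%N.
  by have /andP[h0 h1] := coord1 (X c) i; rewrite truncn_lt_nat.
pose box (c : {ffun 'I_m -> 'I_K}) : {ffun 'I_k -> 'I_N} :=
  [ffun i => Ordinal (boxlt c i)].
have box_inj : injective box.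
  move=> c d /ffunP cd.
  have KW0 : 0 < (K * W)%:R :> R by rewrite ltr0n muln_gt0.
  have Xcd : `|\val (X c) - \val (X d)| <= (K * W)%:R^-1.
    apply: rV_norm_le => [|i]; first by rewrite invr_ge0 ltW.
    have := cd i; rewrite !ffunE => /(congr1 val) /= e.
    have /andP[c0 _] := coord1 (X c) i; have /andP[d0 _] := coord1 (X d) i.
    have /andP[cl cr] := truncn_itv c0; have /andP[dl dr] := truncn_itv d0.
    rewrite !mxE -(ler_pM2r KW0) mulVf ?gt_eqF // -[X in `|_| * X]gtr0_norm //.
    rewrite -normrM mulrBl; move: cl cr dl dr; rewrite e -natr1 => cl cr dl dr.
    rewrite !mulrDl !mul1r in cl cr dl dr.
    rewrite ler_norml; apply/andP; split; lra.
  apply/ffunP => i; apply/val_inj/eqP; apply/negPn/negP => cdi.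
  have : eta / K%:R <= `|p c - p d|.
    apply: (le_trans _ (norm_coord _ i)); rewrite !mxE -mulrBr normrM.
    rewrite gtr0_norm ?divr_gt0 //; apply: ler_peMr.
      by rewrite ltW // divr_gt0.
    have -> : (c i)%:R - (d i)%:R = ((c i : int) - (d i : int))%:~R :> R.
      by rewrite intrB -!pmulrn.
    have : (1 : int) <= `|(c i : int) - (d i : int)|.
      by rewrite -gtz0_ge1 normr_gt0 subr_eq0.
    by rewrite -(ler_int R) intr_norm.
  apply/negP; rewrite -ltNge -!psiX; apply: (le_lt_trans (psiL _ _)).
  apply: (@le_lt_trans _ _ (L%:R * (K * W)%:R^-1)); first by rewrite ler_wpM2l.
  by rewrite ltr_pdivrMr // natrM mulrA mulfVK ?gt_eqF // mulrC.
have := leq_card _ box_inj; rewrite !card_ffun !card_ord; apply/negP.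
rewrite -ltnNge; apply: (@leq_ltn_trans ((K * (2 * W).+1) ^ k)%N).
  have [->|k0] := posnP k; first by [].
  by rewrite leq_exp2r // /N; nia.
apply: (@leq_trans (K ^ k.+1)%N); last by rewrite leq_exp2l // ltnS expn_gt0.
by rewrite expnMn expnS mulnC ltn_pmul2r ?expn_gt0 // ltnS.
Qed.

(** General position: a map from a k-disk to a space of dimension m > k can be moved
    off the origin.  Translate a Lipschitz approximation by a point that it misses. *)
Lemma disk_nonvanishing_approx k m (phi : disk R k -> 'rV[R]_m) (eps : R) :
  (k < m)%N -> continuous phi -> 0 < eps ->
  exists psi : disk R k -> 'rV[R]_m,
    [/\ continuous psi, forall x, `|psi x - phi x| < eps
      & forall x, psi x != 0].
Proof.
move=> km cphi eps0; have e3 : 0 < eps / 3 by rewrite divr_gt0.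
have [L [psi [near_phi psiL]]] := disk_lipschitz_approx cphi e3.
have [p [pe psip]] := lipschitz_avoids km e3 psiL.
exists (fun x => psi x - p); split=> [|x|x].
- apply: (@lipschitz_continuous _ _ _ L) => x y.
  by rewrite opprD opprK addrACA addNr addr0.
- rewrite addrAC; apply: (le_lt_trans (ler_normB _ _)).
  by have := near_phi x; lra.
- by rewrite subr_eq0.
Qed.
End Avoid.


(** * Extending maps into a contractible space *)

Section Normalize.
Variable R : realType.

Definition enorm n (x : 'rV[R]_n) : R := Num.sqrt (sqnorm x).

Lemma enorm_gt0 n (x : 'rV[R]_n) : (0 < enorm x) = (x != 0).
Proof. by rewrite sqrtr_gt0 lt_def sqnorm_eq0 sqnorm_ge0 andbT. Qed.

Lemma enormZ n a (x : 'rV[R]_n) : enorm (a *: x) = `|a| * enorm x.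
Proof. by rewrite /enorm sqnormZ sqrtrM ?sqr_ge0 // sqrtr_sqr. Qed.

Lemma enorm_sq n (x : 'rV[R]_n) : enorm x ^+ 2 = sqnorm x.
Proof. by rewrite sqr_sqrtr ?sqnorm_ge0. Qed.

Lemma enorm_le1 n (x : 'rV[R]_n) : (enorm x <= 1) = (sqnorm x <= 1).
Proof. by rewrite -[X in _ <= X]sqrtr1 ler_sqrt. Qed.

Lemma enorm_continuous n : continuous (@enorm n).
Proof.
exact: (comp_continuous (@sqnorm_continuous R n) (@sqrt_continuous R)).
Qed.

Lemma disk_enorm n (x : disk R n) : enorm (\val x) <= 1.
Proof. by rewrite enorm_le1; exact: (set_valP x). Qed.

Lemma sphere_sqnorm n (x : sphere R n) : sqnorm (\val x) = 1.
Proof. exact: (set_valP x). Qed.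

Lemma sphere_enorm n (x : sphere R n) : enorm (\val x) = 1.
Proof. by rewrite /enorm sphere_sqnorm sqrtr1. Qed.

Lemma sphere_diskE n (s : sphere R n) : \val (sphere_disk s) = \val s.
Proof. by rewrite /= set_valE. Qed.

(** The value at 0 is an arbitrary point of the sphere. *)
Definition unit_vec n (v : 'rV[R]_n.+1) : 'rV[R]_n.+1 :=
  if v == 0 then delta_mx 0 0 else (enorm v)^-1 *: v.

Lemma unit_vec_sphere n (v : 'rV[R]_n.+1) : unit_vec v \in @sphere_set R n.+1.
Proof.
apply/mem_set; rewrite /sphere_set /unit_vec /=; case: eqVneq => [_|v0].
  rewrite /sqnorm (bigD1 ord0) //= big1 ?addr0 => [|i i0].
    by rewrite mxE !eqxx expr1n.
  by rewrite mxE eqxx (negbTE i0) expr0n.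
by rewrite sqnormZ -enorm_sq -exprMn mulVf ?expr1n // gt_eqF // enorm_gt0.
Qed.

Definition normalize n (v : 'rV[R]_n.+1) : sphere R n.+1 :=
  exist _ (unit_vec v) (unit_vec_sphere v).

Lemma normalizeE n (v : 'rV[R]_n.+1) : v != 0 ->
  \val (normalize v) = (enorm v)^-1 *: v.
Proof. by rewrite /= /unit_vec => /negbTE ->. Qed.

Lemma normalizeZ n a (v : 'rV[R]_n.+1) : 0 < a -> v != 0 ->
  normalize (a *: v) = normalize v.
Proof.
move=> a0 v0; apply/val_inj; rewrite !normalizeE ?scaler_eq0 ?gt_eqF //=.
rewrite enormZ gtr0_norm // scalerA invfM mulrAC mulVf ?mul1r //.
by rewrite gt_eqF.
Qed.

Lemma normalize_val n (s : sphere R n.+1) : normalize (\val s) = s.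
Proof.
apply/val_inj; rewrite normalizeE ?sphere_enorm ?invr1 ?scale1r //.
by rewrite -enorm_gt0 sphere_enorm.
Qed.

Lemma normalize_at (T : topologicalType) n (f : T -> 'rV[R]_n.+1) x :
  {for x, continuous f} -> f x != 0 ->
  {for x, continuous (fun y => normalize (f y))}.
Proof.
move=> cf fx0; apply: set_type_at.
have ef : {for x, continuous (fun y => enorm (f y))}.
  by apply: comp_at cf _; exact: enorm_continuous.
have c1 : (fun y => (enorm (f y))^-1 *: f y) @ nbhs x --> \val (normalize (f x)).
  rewrite normalizeE //; apply: (@cvgZ _ _ _ (nbhs x)) => //.
  by apply: (@cvgV _ _ (nbhs x)) => //; rewrite gt_eqF // enorm_gt0.
apply: cvg_trans c1; apply: (@near_eq_cvg _ _ (nbhs x)).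
have : \forall y \near x, 0 < enorm (f y).
  apply: (ef [set r | 0 < r]); apply: open_nbhs_nbhs.
  by split; [exact: open_gt|rewrite /= enorm_gt0].
by apply: filterS => y; rewrite enorm_gt0 => /normalizeE ->.
Qed.

(** The retraction of Euclidean space onto the unit disk. *)
Definition clip_vec n (v : 'rV[R]_n) : 'rV[R]_n := (Num.max 1 (enorm v))^-1 *: v.

Lemma clip_vec_disk n (v : 'rV[R]_n) : clip_vec v \in @disk_set R n.
Proof.
apply/mem_set; rewrite /disk_set /clip_vec /= -enorm_le1 enormZ.
have m0 : 0 < Num.max 1 (enorm v) by rewrite lt_max ltr01.
by rewrite gtr0_norm ?invr_gt0 // mulrC ler_pdivrMr // mul1r le_max lexx orbT.
Qed.

Definition clip n (v : 'rV[R]_n) : disk R n := exist _ (clip_vec v) (clip_vec_disk v).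

Lemma clipE n (v : 'rV[R]_n) : enorm v <= 1 -> \val (clip v) = v.
Proof. by move=> v1; rewrite /= /clip_vec max_l // invr1 scale1r. Qed.

Lemma clip_val n (x : disk R n) : clip (\val x) = x.
Proof. by apply/val_inj; rewrite clipE // disk_enorm. Qed.

Lemma clip_continuous n : continuous (@clip n).
Proof.
move=> v; apply: set_type_at; rewrite /= /clip_vec.
apply: (@cvgZ _ _ _ (nbhs v)) => //.
apply: (@cvgV _ _ (nbhs v)); first by rewrite gt_eqF // lt_max ltr01.
apply: (@continuous_max _ _ (fun=> 1) (@enorm n) v); first exact: cst_continuous.
exact: enorm_continuous.
Qed.

Definition clamp01 (r : R) : R := Num.max 0 (Num.min 1 r).

Lemma clamp01_in r : clamp01 r \in (`[0, 1]%classic : set R).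
Proof.
apply/mem_set; rewrite /clamp01 /= in_itv /= le_max lexx /=.
by rewrite ge_max ler01 ge_min lexx.
Qed.

Definition clampI (r : R) : unit_interval R := exist _ (clamp01 r) (clamp01_in r).

Lemma clampI_at (T : topologicalType) (f : T -> R) x :
  {for x, continuous f} -> {for x, continuous (fun y => clampI (f y))}.
Proof.
move=> cf; apply: set_type_at; rewrite /= /clamp01.
apply: (@continuous_max _ _ (fun=> 0) (fun y => Num.min 1 (f y)) x).
  exact: cst_continuous.
by apply: (@continuous_min _ _ (fun=> 1) f x) => //; exact: cst_continuous.
Qed.

Lemma clampI_continuous : continuous clampI.
Proof. by move=> r; apply: clampI_at; exact: cvg_id. Qed.

Lemma clamp01_continuous : continuous clamp01.
Proof.
exact: (comp_continuous clampI_continuous (@set_type_val_continuous _ _)).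
Qed.

Lemma clampI_le0 r : r <= 0 -> clampI r = I0 R.
Proof.
move=> r0; apply/val_inj; rewrite /= /clamp01 min_r ?(le_trans r0) //.
by rewrite max_l.
Qed.

Lemma clampI_ge1 r : 1 <= r -> clampI r = I1 R.
Proof. by move=> r1; apply/val_inj; rewrite /= /clamp01 min_l // max_r. Qed.

Definition ival (t : unit_interval R) : R := \val t.

Lemma ival_continuous : continuous ival.
Proof. exact: set_type_val_continuous. Qed.

Lemma ival_bounds (t : unit_interval R) : 0 <= ival t <= 1.
Proof. by have := set_valP t; rewrite /= in_itv. Qed.

Lemma clampI_ival (t : unit_interval R) : clampI (ival t) = t.
Proof.
apply/val_inj; have /andP[t0 t1] := ival_bounds t.
by rewrite /= /clamp01 min_r // max_r.
Qed.

End Normalize.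

Section Cone.
Variables (R : realType) (Y : topologicalType).
Hypothesis contractY : contractible R Y.

(** The common source of all extension results.  Think of [nu] as the distance to a
    centre and of [nu = 1] as the boundary on which a map is prescribed; [Phi] extends it
    by radial projection, which is singular at the centre.  Contracting the values of [Phi]
    while [nu] decreases from 1 to 1 / 2 makes the map constant before the
    singularity is reached. *)
Lemma cone_extension (T : topologicalType) (nu : T -> R) (Phi : T -> Y) :
  continuous nu -> {within [set z | 1 / 2 <= nu z], continuous Phi} ->
  exists Theta : T -> Y, continuous Theta /\ forall z, 1 <= nu z -> Theta z = Phi z.
Proof.
move=> cnu cPhi; have [c [K [cK K0 K1]]] := contractY.
pose Theta z := if 1 / 2 <= nu z then K (Phi z, clampI (2 * (1 - nu z))) else c.
exists Theta; split; last first.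
  move=> z nz; rewrite /Theta ifT; last by lra.
  by rewrite clampI_le0 //; lra.
apply/continuous_subspace_setT.
rewrite (_ : setT = [set z | 1 / 2 <= nu z] `|` [set z | nu z <= 1 / 2]); last first.
  rewrite predeqE => z; split=> // _ /=.
  by case: (leP (1 / 2) (nu z)) => h; [left|right; exact: ltW].
have cr : continuous (fun r : R => clampI (2 * (1 - r))).
  apply: (@comp_continuous _ _ _ (fun r : R => 2 * (1 - r))); last first.
    exact: clampI_continuous.
  move=> r; apply: (@cvgM _ _ (nbhs r)); first exact: cst_continuous.
  by apply: (@cvgB _ _ _ (nbhs r)); [exact: cvg_cst|exact: cvg_id].
have /continuous_closedP nuP := cnu.
apply: withinU_continuous.
- exact: (nuP _ (@closed_ge R (1 / 2))).
- exact: (nuP _ (@closed_le R (1 / 2))).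
- apply: (@subspace_eq_continuous _ _ _
    (fun z => K (Phi z, clampI (2 * (1 - nu z))))).
    by move=> z /set_mem /= h; rewrite /from_subspace /Theta ifT.
  apply: comp_continuous cK; apply: pair_continuous => //.
  by apply: continuous_subspaceT; exact: comp_continuous cnu cr.
- apply: (@subspace_eq_continuous _ _ _ (fun=> c)).
    move=> z /set_mem /= h; rewrite /from_subspace /Theta; case: ifP => // h'.
    by rewrite clampI_ge1 ?K1 //; lra.
  by move=> z; exact: cvg_cst.
Qed.

Lemma sphere_extension n (g : sphere R n.+1 -> Y) : continuous g ->
  exists G : disk R n.+1 -> Y, continuous G /\ forall s, G (sphere_disk s) = g s.
Proof.
move=> cg; pose nu (x : disk R n.+1) := sqnorm (\val x).
have cnu : continuous nu.
  exact: (comp_continuous (@set_type_val_continuous _ _) (@sqnorm_continuous R n.+1)).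
have [|G [cG GE]] := @cone_extension _ nu (fun x => g (normalize (\val x))) cnu.
  apply: continuous_in_subspaceT => x /set_mem /= nux.
  apply: (@comp_at _ _ _ (fun y : disk R n.+1 => normalize (\val y)) g x _ (cg _)).
  apply: normalize_at.
    exact: set_type_val_continuous.
  by rewrite -sqnorm_eq0 gt_eqF //; rewrite /nu in nux; lra.
exists G; split=> // s; rewrite GE /nu ?sphere_diskE ?normalize_val //.
by rewrite sphere_sqnorm.
Qed.

End Cone.

Section PathExtension.
Variables (R : realType) (Y : topologicalType).
Hypothesis contractY : contractible R Y.

Lemma path_join (u v : Y) : exists h : unit_interval R -> Y,
  [/\ continuous h, h (I0 R) = u & h (I1 R) = v].
Proof.
pose nu (t : unit_interval R) : R := `|2 * ival t - 1|.
have cs : continuous (fun t : unit_interval R => 2 * ival t - 1).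
  move=> t; apply: (@cvgB _ _ _ (nbhs t)); last exact: cvg_cst.
  apply: (@cvgM _ _ (nbhs t)); first exact: cvg_cst.
  exact: ival_continuous.
have cnu : continuous nu := comp_continuous cs (@norm_continuous _ _).
pose Phi (t : unit_interval R) := if ival t <= 1 / 2 then u else v.
have [|h [ch hE]] := cone_extension contractY (Phi := Phi) cnu.
  have /continuous_closedP cvP := @ival_continuous R.
  apply: (@continuous_subspaceW _ _ _
    ([set t : unit_interval R | ival t <= 1 / 4]
     `|` [set t : unit_interval R | 3 / 4 <= ival t])).
    rewrite /nu => t /=; rewrite ler_normr => /orP[] h; [right|left] => /=.
      by lra.
    by lra.
  apply: withinU_continuous.
  - exact: (cvP _ (@closed_le R (1 / 4))).
  - exact: (cvP _ (@closed_ge R (3 / 4))).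
  - apply: (@subspace_eq_continuous _ _ _ (fun=> u)); last exact: cst_continuous.
    by move=> t /set_mem /= h; rewrite /from_subspace /Phi ifT //; lra.
  - apply: (@subspace_eq_continuous _ _ _ (fun=> v)); last exact: cst_continuous.
    move=> t /set_mem /= h; rewrite /from_subspace /Phi ifF //.
    by apply/negbTE; rewrite -ltNge; lra.
exists h; split=> //.
  have i0 : ival (I0 R) = 0 by [].
  by rewrite hE /nu /Phi i0 ?mulr0 ?add0r ?normrN1 // ifT // divr_ge0.
have i1 : ival (I1 R) = 1 by [].
rewrite hE /nu /Phi i1; last by rewrite ler_normr; apply/orP; left; lra.
by rewrite ifF //; apply/negbTE; rewrite -ltNge; lra.
Qed.

(** The boundary of the cylinder over a disk is filled by [cone_extension], where
    [Phi] composes the given maps with the projection of the cylinder to its boundary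
    from the centre: [side], [bot] and [top] are the formulas on the parts of the
    cylinder that project to the three faces. *)
Lemma path_extension n (u v : disk R n.+1 -> Y)
    (g : (sphere R n.+1 * unit_interval R)%type -> Y) :
  continuous u -> continuous v -> continuous g ->
  (forall s, g (s, I0 R) = u (sphere_disk s)) ->
  (forall s, g (s, I1 R) = v (sphere_disk s)) ->
  exists H : (disk R n.+1 * unit_interval R)%type -> Y,
    [/\ continuous H, forall x, H (x, I0 R) = u x, forall x, H (x, I1 R) = v x
      & forall s t, H (sphere_disk s, t) = g (s, t)].
Proof.
move=> cu cv cg g0 g1.
pose T := (disk R n.+1 * unit_interval R)%type.
pose X (z : T) : 'rV[R]_n.+1 := \val z.1.
pose rho (z : T) : R := enorm (X z).
pose sg (z : T) : R := 2 * ival z.2 - 1.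
have cX : continuous X.
  exact: (comp_continuous (@fst_continuous _ _) (@set_type_val_continuous _ _)).
have crho : continuous rho := comp_continuous cX (@enorm_continuous R n.+1).
have csg : continuous sg.
  move=> z; apply: (@cvgB _ _ _ (nbhs z)); last exact: cvg_cst.
  apply: (@cvgM _ _ (nbhs z)); first exact: cvg_cst.
  exact: (comp_continuous (@snd_continuous _ _) (@ival_continuous R)).
pose nu (z : T) := Num.max (rho z) `|sg z|.
have cnu : continuous nu.
  move=> z; apply: (@continuous_max _ _ rho (fun z => `|sg z|) z); first exact: crho.
  exact: (comp_continuous csg (@norm_continuous _ _)).
pose side (z : T) := g (normalize (X z), clampI ((sg z / rho z + 1) / 2)).
pose bot (z : T) := u (clip ((- sg z)^-1 *: X z)).
pose top (z : T) := v (clip ((sg z)^-1 *: X z)).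
pose Phi (z : T) :=
  if `|sg z| <= rho z then side z else if sg z <= 0 then bot z else top z.
have rho_neq0 z : 0 < rho z -> X z != 0 by rewrite enorm_gt0.
have side_at z : 0 < rho z -> {for z, continuous side}.
  move=> r0; apply: (@comp_at _ _ _ _ g z _ (cg _)); apply: pair_at.
    by apply: normalize_at; [exact: cX|exact: rho_neq0].
  apply: clampI_at; apply: (@cvgM _ _ (nbhs z)); last exact: cvg_cst.
  apply: (@cvgD _ _ _ (nbhs z)); last exact: cvg_cst.
  apply: (@cvgM _ _ (nbhs z)); first exact: csg.
  by apply: (@cvgV _ _ (nbhs z)); [rewrite gt_eqF|exact: crho].
have clip_at (f : T -> R) z : {for z, continuous f} -> f z != 0 ->
    {for z, continuous (fun z => clip ((f z)^-1 *: X z))}.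
  move=> cf f0; apply: (@comp_at _ _ _ _ (@clip R n.+1) z).
    apply: (@cvgZ _ _ _ (nbhs z)); last exact: cX.
    exact: (@cvgV _ _ (nbhs z)).
  exact: clip_continuous.
have bot_at z : sg z < 0 -> {for z, continuous bot}.
  move=> s0; apply: (@comp_at _ _ _ _ u z _ (cu _)).
  apply: (clip_at (fun z => - sg z)); last by rewrite oppr_eq0 lt_eqF.
  by apply: (@cvgN _ _ _ (nbhs z)); exact: csg.
have top_at z : 0 < sg z -> {for z, continuous top}.
  move=> s0; apply: (@comp_at _ _ _ _ v z _ (cv _)).
  by apply: clip_at; [exact: csg|rewrite gt_eqF].
have side_bot z : 0 < rho z -> sg z = - rho z -> side z = bot z.
  move=> r0 e; rewrite /side /bot e opprK mulNr divff ?gt_eqF //.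
  rewrite addNr mul0r clampI_le0 // g0; congr u; apply: val_inj.
  rewrite sphere_diskE normalizeE ?rho_neq0 // clipE //.
  by rewrite enormZ gtr0_norm ?invr_gt0 // mulVf ?gt_eqF.
have side_top z : 0 < rho z -> sg z = rho z -> side z = top z.
  move=> r0 e; rewrite /side /top e divff ?gt_eqF //.
  rewrite clampI_ge1 ?g1; last by lra.
  congr v; apply: val_inj.
  rewrite sphere_diskE normalizeE ?rho_neq0 // clipE //.
  by rewrite enormZ gtr0_norm ?invr_gt0 // mulVf ?gt_eqF.
have [|H [cH HE]] := cone_extension contractY (Phi := Phi) cnu.
  have closed_le_fun (f h : T -> R) : continuous f -> continuous h ->
      closed [set z | f z <= h z].
    move=> cf ch; have cd : continuous (fun z => h z - f z).
      by move=> z; apply: (@cvgB _ _ _ (nbhs z)); [exact: ch|exact: cf].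
    rewrite (_ : mkset _ = (fun z => h z - f z) @^-1` [set r | 0 <= r]).
      by move/continuous_closedP : cd => /(_ _ (@closed_ge R 0)).
    by apply/seteqP; split=> z /=; rewrite subr_ge0.
  have chalf : continuous (fun _ : T => 1 / 2 : R) by exact: cst_continuous.
  have cNsg : continuous (fun z => - sg z).
    by move=> z; apply: (@cvgN _ _ _ (nbhs z)); exact: csg.
  have cabs : continuous (fun z => `|sg z|).
    exact: (comp_continuous csg (@norm_continuous _ _)).
  pose A1 := [set z | 1 / 2 <= rho z] `&` [set z | `|sg z| <= rho z].
  pose A2 := [set z | 1 / 2 <= - sg z] `&` [set z | rho z <= - sg z].
  pose A3 := [set z | 1 / 2 <= sg z] `&` [set z | rho z <= sg z].
  have cA1 : closed A1.
    apply: closedI; first exact: closed_le_fun _ _ chalf crho.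
    exact: closed_le_fun _ _ cabs crho.
  have cA2 : closed A2.
    apply: closedI; first exact: closed_le_fun _ _ chalf cNsg.
    exact: closed_le_fun _ _ crho cNsg.
  have cA3 : closed A3.
    apply: closedI; first exact: closed_le_fun _ _ chalf csg.
    exact: closed_le_fun _ _ crho csg.
  apply: (@continuous_subspaceW _ _ _ (A1 `|` (A2 `|` A3))).
    move=> z /=; rewrite /nu; have [rs|sr] := leP (rho z) `|sg z|.
      have [s0|s0] := leP 0 (sg z).
        by rewrite ger0_norm // in rs *; right; right; split.
      by rewrite ltr0_norm // in rs *; right; left; split.
    by move=> h; left; split => //=; exact: ltW.
  apply: withinU_continuous => //; [exact: closedU| |apply: withinU_continuous => //].
  - apply: (@subspace_eq_continuous _ _ _ side).
      by move=> z /set_mem [_ /= h]; rewrite /from_subspace /Phi ifT.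
    apply: continuous_in_subspaceT => z /set_mem [/= h _]; apply: side_at; lra.
  - apply: (@subspace_eq_continuous _ _ _ bot); last first.
      apply: continuous_in_subspaceT => z /set_mem [/= h _]; apply: bot_at; lra.
    move=> z /set_mem [/= h1 h2]; rewrite /from_subspace /Phi.
    have s0 : sg z <= 0 by lra.
    rewrite s0 ler0_norm //; case: ifP => // h3.
    by rewrite side_bot //; lra.
  - apply: (@subspace_eq_continuous _ _ _ top); last first.
      apply: continuous_in_subspaceT => z /set_mem [/= h _]; apply: top_at; lra.
    move=> z /set_mem [/= h1 h2]; rewrite /from_subspace /Phi.
    have s0 : 0 <= sg z by lra.
    rewrite ger0_norm // [sg z <= 0]leNgt (_ : 0 < sg z); last by lra.
    case: ifP => // h3; by rewrite side_top //; lra.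
have sgI0 x : sg (x, I0 R) = -1 by rewrite /sg /= mulr0 add0r.
have sgI1 x : sg (x, I1 R) = 1 by rewrite /sg /= mulr1; lra.
have rho1 z : rho z <= 1 by exact: disk_enorm.
exists H; split=> // [x|x|s t].
- rewrite HE; last by rewrite /nu sgI0 normrN1 le_max lexx orbT.
  have botE : bot (x, I0 R) = u x.
    by rewrite /bot sgI0 opprK invr1 scale1r clip_val.
  rewrite /Phi sgI0 normrN1 oppr_le0 ler01 botE; case: ifP => // r1.
  have re : rho (x, I0 R) = 1 by apply/le_anti; rewrite rho1.
  by rewrite side_bot ?re ?sgI0.
- rewrite HE; last by rewrite /nu sgI1 normr1 le_max lexx orbT.
  have topE : top (x, I1 R) = v x.
    by rewrite /top sgI1 invr1 scale1r clip_val.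
  rewrite /Phi sgI1 normr1 [1 <= 0]leNgt ltr01 topE; case: ifP => // r1.
  have re : rho (x, I1 R) = 1 by apply/le_anti; rewrite rho1.
  by rewrite side_top ?re ?sgI1.
- have re : rho (sphere_disk s, t) = 1 by rewrite /rho /X sphere_diskE sphere_enorm.
  rewrite HE; last by rewrite /nu re le_max lexx.
  have /andP[t0 t1] := ival_bounds t.
  rewrite /Phi ifT; last by rewrite re ler_norml /sg /=; apply/andP; split; lra.
  rewrite /side re divr1 /X sphere_diskE normalize_val /sg /=.
  by rewrite (_ : (2 * ival t - 1 + 1) / 2 = ival t) ?clampI_ival //; lra.
Qed.

End PathExtension.

(** * Topology of a cell attachment *)

Lemma disk_sphere (R : realType) n (x : disk R n.+1) :
  ~~ (sqnorm (\val x) < 1) -> x = sphere_disk (normalize (\val x)).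
Proof.
rewrite -leNgt => x1; have x1' : sqnorm (\val x) = 1.
  by apply/le_anti; rewrite x1 andbT; exact: (set_valP x).
apply/val_inj; rewrite sphere_diskE normalizeE -?sqnorm_eq0 ?x1' ?oner_eq0 //.
by rewrite /enorm x1' sqrtr1 invr1 scale1r.
Qed.

Section CellAttachment.
Variables (R : realType) (M : monoidType) (n : nat) (P : mset M) (A B : mspace M).
Let PS := prod_mspace (discrete_mspace P) (trivial_mspace M (sphere R n.+1)).
Let PD := prod_mspace (discrete_mspace P) (trivial_mspace M (disk R n.+1)).
Variables (att : PS -> A) (inc : A -> B) (chr : PD -> B).
Hypothesis po : mspace_pushout att
  ((fun z => (z.1, sphere_disk z.2)) : PS -> PD) inc chr.

Lemma attach_att_continuous : continuous att. Proof. by have [[[]]] := po. Qed.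
Definition cell_radius (z : PD) : R := sqnorm (\val z.2).

Definition cell_dir (z : PD) : PS := (z.1, normalize (\val z.2)).

Lemma cell_radius_continuous : continuous cell_radius.
Proof.
apply: (comp_continuous _ (@sqnorm_continuous R n.+1)).
exact: (comp_continuous (@snd_continuous _ _) (@set_type_val_continuous _ _)).
Qed.

Lemma chr_boundary z : ~~ (cell_radius z < 1) -> chr z = inc (att (cell_dir z)).
Proof.
case: z => p x x1; have [_ comm _] := po.
by rewrite comm /=; congr (chr (_, _)); exact: disk_sphere.
Qed.

Lemma cell_dir_at z : 0 < cell_radius z -> {for z, continuous cell_dir}.
Proof.
move=> r0; apply: pair_at; first exact: fst_continuous.
apply: normalize_at; last by rewrite -sqnorm_eq0 gt_eqF.
exact: (comp_continuous (@snd_continuous _ _) (@set_type_val_continuous _ _)).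
Qed.

Lemma attach_cover (y : B) :
  (exists a, y = inc a) \/ (exists z, cell_radius z < 1 /\ y = chr z).
Proof.
pose D : set B := [set y | (exists a, y = inc a) \/
  (exists z, cell_radius z < 1 /\ y = chr z)].
have : (fun y => `[< D y >] : indiscrete bool) = (fun=> true).
  apply: (pushout_top_uniq po).
  - exact: indiscrete_continuous.
  - exact: indiscrete_continuous.
  - by move=> a; apply/asboolP; left; exists a.
  - move=> z; apply/asboolP; have [z1|z1] := boolP (cell_radius z < 1).
      by right; exists z.
    by left; exists (att (cell_dir z)); exact: chr_boundary.
by move=> /(congr1 (fun f => f y)) /asboolP.
Qed.

(** As a set, the pushout is the disjoint union of [A] and the open cells. *)
Lemma attach_coord_ex : exists w : B -> (A + PD)%type,
  (forall a, w (inc a) = inl a) /\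
  (forall z, w (chr z) = if cell_radius z < 1 then inr z else inl (att (cell_dir z))).
Proof.
have [|||w [_ wi wc]] := pushout_top po (Z := indiscrete (A + PD)%type)
  (u := fun a => inl a)
  (v := fun z => if cell_radius z < 1 then inr z else inl (att (cell_dir z))).
- exact: indiscrete_continuous.
- exact: indiscrete_continuous.
- move=> [p s]; rewrite /cell_radius /cell_dir /= set_valE normalize_val.
  by rewrite sphere_sqnorm ltxx.
by exists w.
Qed.

Definition attach_coord : B -> (A + PD)%type := projT1 (cid attach_coord_ex).
Let w := attach_coord.

Lemma attach_coord_inc a : w (inc a) = inl a.
Proof. exact: (projT2 (cid attach_coord_ex)).1. Qed.

Lemma attach_coord_chr z :
  w (chr z) = if cell_radius z < 1 then inr z else inl (att (cell_dir z)).
Proof. exact: (projT2 (cid attach_coord_ex)).2. Qed.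

Lemma attach_coord_inl y a : w y = inl a -> y = inc a.
Proof.
case: (attach_cover y) => [[b ->]|[z [z1 ->]]].
  by rewrite attach_coord_inc => -[->].
by rewrite attach_coord_chr z1.
Qed.

Lemma attach_coord_inr y z : w y = inr z -> cell_radius z < 1 /\ y = chr z.
Proof.
case: (attach_cover y) => [[b ->]|[z' [z1 ->]]].
  by rewrite attach_coord_inc.
by rewrite attach_coord_chr z1 => -[<-].
Qed.

Lemma attach_inj : injective inc.
Proof.
move=> a b /(congr1 w); rewrite !attach_coord_inc => -[].
by [].
Qed.

Lemma attach_open (O : set B) :
  open (inc @^-1` O) -> open (chr @^-1` O) -> open O.
Proof.
move=> oi oc; have [||x|v [cv vi vc]] := pushout_top po (Z := sierpinski)
  (u := fun a => `[< O (inc a) >]) (v := fun z => `[< O (chr z) >]).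
- exact: (sierpinski_continuous oi).
- exact: (sierpinski_continuous oc).
- by have [_ -> _] := po.
have -> : O = [set y | v y]; last exact: sierpinski_open.
apply/seteqP; split=> y /=.
  by case: (attach_cover y) => [[a ->]|[z [_ ->]]] Oy; rewrite ?vi ?vc asboolT.
by case: (attach_cover y) => [[a ->]|[z [_ ->]]]; rewrite ?vi ?vc => /asboolP.
Qed.

Definition coord_set (OA : set A) (OC : set PD) : set B :=
  [set y | match w y with inl a => OA a | inr z => OC z end].

Lemma coord_set_open OA (OC : set PD) : open OA ->
  open [set z | if cell_radius z < 1 then OC z else OA (att (cell_dir z))] ->
  open (coord_set OA OC).
Proof.
move=> oA oC; apply: attach_open.
  rewrite (_ : _ @^-1` _ = OA) //; apply/seteqP; split=> a;
  by rewrite /coord_set /= attach_coord_inc.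
rewrite (_ : _ @^-1` _ =
  [set z | if cell_radius z < 1 then OC z else OA (att (cell_dir z))]) //.
by apply/seteqP; split=> z; rewrite /coord_set /= attach_coord_chr; case: ifP.
Qed.

(** Near its boundary sphere a closed cell retracts radially to the sphere; an open
    subset of [A] thus extends to an open subset of the space with cells attached. *)
Lemma collar_open (O : set A) : open O ->
  open [set z | 1 / 2 < cell_radius z /\ O (att (cell_dir z))].
Proof.
move=> oO; apply: open_nbhsP => z [z1 Oz]; apply: filterI.
  apply: open_nbhs_nbhs; split=> //.
  exact: (preimage_open cell_radius_continuous (@open_gt R (1 / 2))).
have /(_ O) : {for z, continuous (fun z => att (cell_dir z))}.
  apply: (@comp_at _ _ _ cell_dir att z); last exact: attach_att_continuous.
  by apply: cell_dir_at; lra.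
by apply; apply: open_nbhs_nbhs.
Qed.

Lemma collar_coord_open (O : set A) : open O ->
  open (coord_set O [set z | 1 / 2 < cell_radius z /\ O (att (cell_dir z))]).
Proof.
move=> oO; apply: coord_set_open => //.
have := collar_open oO; congr open; apply/seteqP; split=> z /=.
  by move=> [z1 Oz]; case: ifP.
by case: ifPn => // z1 Oz; split=> //; lra.
Qed.

Lemma interior_open : open [set z | cell_radius z < 1].
Proof. exact: (preimage_open cell_radius_continuous (@open_lt R 1)). Qed.

Lemma cell_coord_open (W : set PD) : open W -> open (coord_set set0 W).
Proof.
move=> oW; apply: coord_set_open; first exact: open0.
have := openI oW interior_open; congr open; apply/seteqP; split=> z /=.
  by move=> [Wz ->].
by case: ifP.
Qed.

Lemma attach_closed (C : set A) : closed C -> closed (inc @` C).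
Proof.
move=> cC; rewrite -openC.
have -> : ~` (inc @` C) = coord_set (~` C) setT.
  apply/seteqP; split=> y; rewrite /coord_set /=.
    case e : (w y) => [a|//] nC Ca; apply: nC; exists a => //.
    by rewrite (attach_coord_inl e).
  by move=> h [a Ca yE]; move: h; rewrite -yE attach_coord_inc; exact.
apply: coord_set_open; first exact: closed_openC.
have := openU interior_open (collar_open (closed_openC cC)).
congr open; apply/seteqP; split=> z /=.
  by move=> [->//|[_ nC]]; case: ifP.
by case: ifPn => [|z1 nC]; [left|right; split=> //; lra].
Qed.

Lemma attach_closed1 : (forall a : A, closed [set a]) ->
  forall y : B, closed [set y].
Proof.
move=> clA y; have [[a ->]|[z [z1 ->]]] := attach_cover y.
  by rewrite -image_set1; exact: attach_closed.
rewrite -openC; have -> : ~` [set chr z] = coord_set setT (~` [set z]).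
  apply/seteqP; split=> x; rewrite /coord_set /=.
    case e : (w x) => [//|z'] /= nx zz'; apply: nx.
    by rewrite (attach_coord_inr e).2 zz'.
  by move=> h xE; move: h; rewrite xE attach_coord_chr z1; exact.
apply: coord_set_open; first exact: openT.
have cz : closed [set z].
  have -> : [set z] = fst @^-1` [set z.1] `&`
      (fun x : PD => \val x.2) @^-1` [set \val z.2].
    apply/seteqP; split=> [x ->//|[p x] /= [-> /val_inj ->]].
    by case: (z).
  apply: closedI; apply: preimage_closedT.
  - exact: fst_continuous.
  - exact: discrete_closed.
  - exact: (comp_continuous (@snd_continuous _ _) (@set_type_val_continuous _ _)).
  - exact/accessible_closed_set1/hausdorff_accessible/norm_hausdorff.
have := closed_openC cz; congr open; apply/seteqP; split=> x /=.
  by case: ifP.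
by case: ifPn => // x1 _ xz; move: x1; rewrite xz z1.
Qed.

End CellAttachment.

Section PushOff.
Variables (R : realType) (M : monoidType) (n : nat) (P : mset M) (A B : mspace M).
Let PS := prod_mspace (discrete_mspace P) (trivial_mspace M (sphere R n.+1)).
Let PD := prod_mspace (discrete_mspace P) (trivial_mspace M (disk R n.+1)).
Variables (att : PS -> A) (inc : A -> B) (chr : PD -> B).
Hypothesis po : mspace_pushout att
  ((fun z => (z.1, sphere_disk z.2)) : PS -> PD) inc chr.

Let w := attach_coord po.

(* The constant makes the sup norm exceed [2 * eps] as soon as the squared Euclidean norm
   is at least 1 / 2. *)
Let eps : R := (4 * n.+1%:R)^-1.

Let core_scale (v : 'rV[R]_n.+1) : R := clamp01 (2 * (1 - sqnorm v)).
Let core_weight (v : 'rV[R]_n.+1) : R := clamp01 (2 - `|v| / eps).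

Let eps_gt0 : 0 < eps. Proof. by rewrite invr_gt0 mulr_gt0 // ltr0n. Qed.

Let core_weight_out v : 1 / 2 <= sqnorm v -> core_weight v = 0.
Proof.
move=> v1; rewrite /core_weight /clamp01; apply/max_idPl.
rewrite ge_min; apply/orP; right.
rewrite subr_le0 ler_pdivlMr // leNgt; apply/negP => vlt.
have n1 : 1 <= n.+1%:R :> R by rewrite ler1n.
have e1 : 4 * n.+1%:R * eps = 1 by rewrite divff // gt_eqF // mulr_gt0 // ltr0n.
have := le_trans v1 (sqnorm_le v).
have : `|v| ^+ 2 <= (2 * eps) ^+ 2.
  by rewrite ler_sqr ?nnegrE ?mulr_ge0 // ltW.
have e0 := eps_gt0.
move: (n.+1%:R : R) n1 e1 (`|v| ^+ 2) => N n1 e1 V h1 h2.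
have : N * V <= N * (2 * eps) ^+ 2 by rewrite ler_wpM2l //; lra.
have -> : N * (2 * eps) ^+ 2 = (4 * N * eps) * eps by ring.
rewrite e1 mul1r => h3.
have : 4 * 1 * eps <= 4 * N * eps by rewrite ler_pM2r // ler_pM2l.
by rewrite e1 => h4; lra.
Qed.

Let core_scale_in v : sqnorm v <= 1 / 2 -> core_scale v = 1.
Proof.
move=> v1; rewrite /core_scale /clamp01 min_l ?max_r //; last by lra.
Qed.

Let core_scale_gt0 v : sqnorm v < 1 -> 0 < core_scale v.
Proof.
by move=> v1; rewrite /core_scale /clamp01 lt_max lt_min ltr01 /=; apply/orP; right; lra.
Qed.

(** [Q] is the position inside the open cells, radially rescaled so as to extend by 0
    to [A]; it agrees with the position on the half of the cell where
    the squared radius is at most 1 / 2. [Lam] is 1 near the centres and 0 outside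
    that half. *)
Lemma cell_field : exists (Q : B -> 'rV[R]_n.+1) (Lam : B -> R),
  [/\ continuous Q, continuous Lam,
      forall z, cell_radius z < 1 -> Q (chr z) = core_scale (\val z.2) *: \val z.2
    & forall z, Lam (chr z) = core_weight (\val z.2)].
Proof.
have cval : continuous (fun z : PD => \val z.2).
  exact: (comp_continuous (@snd_continuous _ _) (@set_type_val_continuous _ _)).
have ccs : continuous (fun z : PD => core_scale (\val z.2)).
  have c1 : continuous (fun z : PD => 2 * (1 - sqnorm (\val z.2))).
    move=> z; apply: (@cvgM _ _ (nbhs z)); first exact: cvg_cst.
    apply: (@cvgB _ _ _ (nbhs z)); first exact: cvg_cst.
    exact: (comp_continuous cval (@sqnorm_continuous R n.+1)).
  exact: comp_continuous c1 (@clamp01_continuous R).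
have ccw : continuous (fun z : PD => core_weight (\val z.2)).
  have c1 : continuous (fun z : PD => 2 - `|\val z.2| / eps).
    move=> z; apply: (@cvgB _ _ _ (nbhs z)); first exact: cvg_cst.
    apply: (@cvgM _ _ (nbhs z)); last exact: cvg_cst.
    exact: (comp_continuous cval (@norm_continuous _ _)).
  exact: comp_continuous c1 (@clamp01_continuous R).
have [|||Q [cQ _ Qc]] := pushout_top po (Z := 'rV[R]_n.+1 : topologicalType)
  (u := fun=> 0) (v := fun z : PD => core_scale (\val z.2) *: \val z.2).
- exact: cst_continuous.
- move=> z; apply: (@cvgZ _ _ _ (nbhs z)); last exact: cval.
  exact: ccs.
- move=> [p s]; rewrite /= set_valE /core_scale sphere_sqnorm subrr mulr0.
  by rewrite /clamp01 min_r // maxxx scale0r.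
have [|||Lam [cL _ Lc]] := pushout_top po (Z := R : topologicalType)
  (u := fun=> 0) (v := fun z : PD => core_weight (\val z.2)).
- exact: cst_continuous.
- exact: ccw.
- move=> [p s]; rewrite /= set_valE core_weight_out // sphere_sqnorm; lra.
by exists Q, Lam; split.
Qed.

(** The inductive step of cellular approximation.  [Q] composed with [f] is a map from a
    disk to a space of larger dimension, so it has a nearby map [g] without zeros. Inside
    the open cells, replace the position by its perturbation [q], which equals [g] near
    the centres and is unchanged outside the core.  As [q] misses the centres, it can be
    projected radially to the boundary of the cell, and hence to [A]. *)
Lemma push_off_cells k (f : disk R k -> B) : (k <= n)%N -> continuous f ->
  exists l : disk R k -> A, continuous l /\ forall x a, f x = inc a -> l x = a.
Proof.
move=> kn cf; have [Q [Lam [cQ cL QE LE]]] := cell_field.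
have cQf := comp_continuous cf cQ; have cLf := comp_continuous cf cL.
have [g [cg gQ g0]] := @disk_nonvanishing_approx R k n.+1 _ _ kn cQf eps_gt0.
pose q x := Q (f x) + Lam (f x) *: (g x - Q (f x)).
pose l x := match w (f x) with inl a => a
            | inr z => att (z.1, normalize (q x)) end.
have cq : continuous q.
  move=> x; apply: (@cvgD _ _ _ (nbhs x)); first exact: cQf.
  apply: (@cvgZ _ _ _ (nbhs x)); first exact: cLf.
  by apply: (@cvgB _ _ _ (nbhs x)); [exact: cg|exact: cQf].
have q0 x z : w (f x) = inr z -> q x != 0.
  move=> /(attach_coord_inr (po := po)) [z1 fx].
  have gx := gQ x; rewrite /q; rewrite fx in gx *; rewrite LE QE //= in gx *.
  set v := \val z.2 in gx *; have vr : sqnorm v < 1 by [].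
  have s0 := core_scale_gt0 vr.
  have [big|small] := leP (1 / 2) (sqnorm v).
    rewrite core_weight_out // scale0r addr0 scaler_eq0 gt_eqF //=.
    by rewrite -sqnorm_eq0 gt_eqF //; lra.
  rewrite core_scale_in ?scale1r ?(ltW small) // in gx *.
  have [ve|ve] := leP `|v| eps.
    have -> : core_weight v = 1.
      rewrite /core_weight /clamp01 min_l ?max_r //.
      have : `|v| / eps <= 1 by rewrite ler_pdivrMr // mul1r.
      by move: (`|v| / eps) => r; lra.
    by rewrite scale1r addrC subrK g0.
  apply/negP => /eqP /(canRL (addrK _)); rewrite sub0r => vE.
  have : `|v| <= `|g x - v|.
    rewrite {1}vE normrN normrZ ler_piMl //.
    by rewrite ger0_norm /core_weight /clamp01 ?le_max ?lexx // ge_max ler01 ge_min lexx.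
  by rewrite leNgt (lt_trans gx).
exists l; split; last first.
  by move=> x a fx; rewrite /l fx /w attach_coord_inc.
have catt := attach_att_continuous po.
move=> x0; case e0 : (w (f x0)) => [a0|z0].
  (* [f x0] lies in [A]: nearby the perturbation is switched off, and [l] is the
     radial retraction of a collar. *)
  have lx0 : l x0 = a0 by rewrite /l e0.
  move=> U; rewrite lx0 nbhsE => -[O [oO Oa0] OU].
  have := preimage_open cf (collar_coord_open po oO).
  set V := _ @^-1` _ => oV.
  have Vx0 : nbhs x0 V.
    by apply: open_nbhs_nbhs; split=> //; rewrite /V /coord_set /= -/w e0.
  change (nbhs x0 (l @^-1` U)); apply: filterS Vx0 => x.
  rewrite /V /coord_set /= -/w /l => Vx; apply: OU; move: Vx.
  case e : (w (f x)) => [a|z] //= [z1 Oz].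
  have [z2 fx] := attach_coord_inr e.
  rewrite /q fx LE core_weight_out ?scale0r ?addr0 ?QE ?(ltW z1) //.
  rewrite normalizeZ ?core_scale_gt0 //.
  by rewrite -sqnorm_eq0 gt_eqF //; move: z1; rewrite /cell_radius; lra.
(* [f x0] lies in an open cell: nearby [l] is given by the formula for that cell. *)
pose W : set PD := [set z | z.1 = z0.1].
have oW : open W.
  exact: (preimage_open (@fst_continuous _ _) (@discrete_open _ [set z0.1])).
have := preimage_open cf (cell_coord_open po oW).
set V := _ @^-1` _ => oV.
have Vx0 : nbhs x0 V.
  by apply: open_nbhs_nbhs; split=> //; rewrite /V /coord_set /= -/w e0.
have cl : {for x0, continuous (fun x => att (z0.1, normalize (q x)))}.
  apply: (@comp_at _ _ _ (fun x => (z0.1, normalize (q x)) : PS) att x0).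
    apply: pair_at; first exact: cst_continuous.
    by apply: normalize_at; [exact: cq|exact: q0 e0].
  exact: catt.
have lx0 : l x0 = att (z0.1, normalize (q x0)) by rewrite /l e0.
rewrite /continuous_at lx0; apply: cvg_trans cl.
apply: (@near_eq_cvg _ _ (nbhs x0)); apply: filterS Vx0 => x.
rewrite /V /coord_set /= -/w /l.
by case e : (w (f x)) => [//|z] ->.
Qed.

End PushOff.

(** * Compact subsets of a sequential colimit *)

Section ClosedExtension.

Definition colimit_ex (Xs : nat -> topologicalType) (i : forall n, Xs n -> Xs n.+1)
    (X : topologicalType) (j : forall n, Xs n -> X) :=
  forall (Z : topologicalType) (u : forall n, Xs n -> Z),
  (forall n, continuous (u n)) -> (forall n x, u n.+1 (i n x) = u n x) ->
  exists w : X -> Z, continuous w /\ forall n x, w (j n x) = u n x.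

(** For [n = 0], the images of [A] in the later stages form a compatible family of
    closed sets. The other stages reduce to this one by omitting initial terms of
    the sequence. *)
Lemma closed_extension n : forall (Xs : nat -> topologicalType)
    (i : forall n, Xs n -> Xs n.+1) (X : topologicalType) (j : forall n, Xs n -> X),
  colimit_ex i j -> (forall n, continuous (i n)) ->
  (forall n, injective (i n)) ->
  (forall n (C : set (Xs n)), closed C -> closed (i n @` C)) ->
  forall A : set (Xs n), closed A ->
  exists C : set X, closed C /\ j n @^-1` C = A.
Proof.
elim: n => [|n IHn] Xs i X j colim ci inj_i cl_i A cA; last first.
  apply: (IHn (fun m => Xs m.+1) (fun m => i m.+1) X (fun m => j m.+1) _ _ _ _ A cA).
  - move=> Z u cu ui.
    pose u' m : Xs m -> Z :=
      match m with 0%N => fun x => u 0%N (i 0%N x) | m'.+1 => u m' end.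
    have [||w [cw wj]] := colim Z u'.
    + by case=> [|m] //=; exact: comp_continuous (ci 0%N) (cu 0%N).
    + by case=> [|m] x //=.
    by exists w; split=> // m x; rewrite (wj m.+1).
  - by move=> m; exact: ci.
  - by move=> m; exact: inj_i.
  - by move=> m; exact: cl_i.
pose As := nat_rect (fun k => set (Xs k)) A (fun k B => i k @` B).
have cAs k : closed (As k) by elim: k => [//|k IHk]; exact: cl_i.
have [||w [cw wj]] := colim sierpinski (fun k x => `[< ~ As k x >]).
- by move=> k; apply: sierpinski_continuous; exact: closed_openC.
- move=> k x; apply/asbool_equiv_eq; split=> nA Ax; apply: nA.
    exact: (ex_intro2 _ _ x Ax erefl).
  by case: Ax => y Ay /inj_i <-.
exists (~` [set y | w y]); split.
  by apply: open_closedC; exact: sierpinski_open.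
apply/seteqP; split=> x /=; rewrite (wj 0%N).
  by move=> nA; apply: contrapT => nAx; apply: nA; exact/asboolP.
by move=> Ax /asboolP; apply.
Qed.

End ClosedExtension.

Section ColimitCompact.
Variables (M : monoidType) (Xs : nat -> mspace M).
Variables (i : forall n, Xs n -> Xs n.+1) (X : mspace M) (j : forall n, Xs n -> X).
Arguments i : clear implicits.
Arguments j : clear implicits.
Hypothesis colim : mspace_seq_colimit i j.
Hypothesis inj_i : forall n, injective (i n).
Hypothesis closed_i : forall n (C : set (Xs n)), closed C -> closed (i n @` C).
Hypothesis closed1 : forall n (x : Xs n), closed [set x].

Lemma colimit_closed_extension n (A : set (Xs n)) : closed A ->
  exists C : set X, closed C /\ j n @^-1` C = A.
Proof.
apply: (@closed_extension n (fun m => Xs m : topologicalType) i X j) => //.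
  by move=> Z u; exact: (colimit_top colim).
by move=> m; have [/(_ m) [[]]] := colim.
Qed.

Lemma colimit_inj n : injective (j n).
Proof.
move=> x y xy; have [C [_ Cx]] := colimit_closed_extension (@closed1 n x).
have Cjx : C (j n x) by have : (j n @^-1` C) x by rewrite Cx.
have : (j n @^-1` C) y by rewrite /preimage /mkset -xy.
by rewrite Cx.
Qed.

Lemma colimit_cover (y : X) : exists n x, y = j n x.
Proof.
pose D : set X := [set y | exists n x, y = j n x].
have : (fun y => `[< D y >] : indiscrete bool) = (fun=> true).
  apply: (colimit_top_uniq colim); try exact: indiscrete_continuous.
  by move=> n x; apply/asboolP; exists n, x.
by move=> /(congr1 (fun f => f y)) /asboolP.
Qed.

Lemma colimit_range n m : (n <= m)%N -> range (j n) `<=` range (j m).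
Proof.
elim: m => [|m IHm]; first by rewrite leqn0 => /eqP ->.
rewrite leq_eqVlt => /predU1P[->//|/IHm nm] _ /nm [x _ <-].
by exists (i m x) => //; have [_ -> _] := colim.
Qed.

Lemma colimit_closed (C : set X) : (forall n, closed (j n @^-1` C)) -> closed C.
Proof.
move=> cC; have [||w [cw wj]] :=
    colimit_top colim (Z := sierpinski) (u := fun n x => `[< ~ C (j n x) >]).
- move=> n; apply: sierpinski_continuous.
  exact: (closed_openC (cC n)).
- by have [_ ji _] := colim; move=> n x; rewrite ji.
rewrite -openC (_ : ~` C = [set y | w y]); first exact: sierpinski_open.
apply/seteqP; split=> y /=; have [n [x ->]] := colimit_cover y; rewrite wj.
  by move=> nC; apply/asboolP.
by move=> /asboolP.
Qed.

(** Otherwise the image contains a sequence of points [f (t l)] outside stage [l].  Only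
    finitely many of these lie in a given stage, so all their tails are closed, and the
    complements of the tails are an increasing open cover without a finite
    subcover. *)
Lemma compact_in_stage (T : topologicalType) (f : T -> X) :
  compact [set: T] -> continuous f -> exists m, range f `<=` range (j m).
Proof.
move=> cT cf; apply: contrapT => nm.
have /choice[t tP] m : exists t, ~ range (j m) (f t).
  apply: contrapT => nt; apply: nm; exists m => _ [t _ <-].
  by apply: contrapT => ?; apply: nt; exists t.
pose F m : set X := [set f (t l) | l in [set l | (m <= l)%N]].
have cF m : closed (F m).
  apply: colimit_closed => n.
  have -> : j n @^-1` F m =
      \bigcup_(l in [set l | (m <= l < n)%N]) (j n @^-1` [set f (t l)]).
    apply/seteqP; split=> x /=.
      move=> [l /= ml xl]; exists l => //=; rewrite ml /= ltnNge; apply/negP => nl.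
      by apply: (tP l); apply: (colimit_range nl); exists x.
    by move=> [l /= /andP[ml _] xl]; exists l.
  apply: closed_bigcup.
    apply: (@sub_finite_set _ _ `I_n); last exact: finite_II.
    by move=> l /= /andP[].
  move=> l _; have [[x _ xE]|nx] := pselect (range (j n) (f (t l))).
    have -> : j n @^-1` [set f (t l)] = [set x]; last exact: closed1.
    by apply/seteqP; split=> y /=; rewrite -xE; [exact: colimit_inj | move=> ->].
  have -> : j n @^-1` [set f (t l)] = set0; last exact: closed0.
  by apply/seteqP; split=> y //= yE; apply: nx; exists y.
have [|||m mF] := compact_increasing_cover cT (U := fun m => f @^-1` (~` F m)).
- by move=> m; exact: preimage_open cf (closed_openC (cF m)).
- move=> m x /= nF [l /= ml lE]; apply: nF; exists l => //=; exact: ltnW.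
- move=> x _; have [n [y yE]] := colimit_cover (f x).
  exists n => /= -[l /= nl lE]; apply: (tP l); apply: (colimit_range nl).
  by exists y; rewrite // lE.
by have := mF (t m) I; apply; exists m => /=.
Qed.

Lemma colimit_lift (T : topologicalType) (f : T -> X) m :
  continuous f -> range f `<=` range (j m) ->
  exists l : T -> Xs m, continuous l /\ forall x, f x = j m (l x).
Proof.
move=> cf fm; have /choice[l lE] x : exists a, f x = j m a.
  by have [|a _ <-] := fm (f x); [exists x|exists a].
exists l; split=> //; apply/continuous_closedP => A cA.
have [C [cC CA]] := colimit_closed_extension cA.
have -> : l @^-1` A = f @^-1` C.
  by rewrite -CA; apply/seteqP; split=> x /=; rewrite lE.
exact: preimage_closedT.
Qed.

End ColimitCompact.

Section Skeleta.
Variables (R : realType) (M : monoidType) (Y : projective_mcw R M).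

Let sk := mcw_skel Y.
Let inc n : sk n -> sk n.+1 := @mcw_incl _ _ Y n.
Let j n : sk n -> Y := @mcw_skel_in _ _ Y n.
Arguments inc : clear implicits.
Arguments j : clear implicits.

Lemma skel_incl_inj n : injective (inc n).
Proof. exact: (attach_inj (mcw_pushout Y n)). Qed.

Lemma skel_incl_closed n (C : set (sk n)) : closed C -> closed (inc n @` C).
Proof. exact: (attach_closed (mcw_pushout Y n)). Qed.

Lemma skel_closed1 n (x : sk n) : closed [set x].
Proof.
elim: n x => [|n IHn]; last exact: (attach_closed1 (mcw_pushout Y n)).
have [_ [g [[cg _] _ gK]]] := mcw_skel0 Y.
move=> x; have -> : [set x] = g @^-1` [set g x].
  by apply/seteqP; split=> y /= => [->//|/(can_inj gK)].
by apply: preimage_closedT => //; exact: discrete_closed.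
Qed.

Lemma skel_in_inj n : injective (j n).
Proof.
exact: (colimit_inj (mcw_colimit Y) skel_incl_inj skel_incl_closed skel_closed1).
Qed.

(** The dimension is written [d + k] since the compression loses one stage at a time,
    until the cells have the dimension of the disk. The conclusion compares points in
    the whole complex, which avoids iterated inclusions of skeleta. *)
Lemma disk_compress k d (f : disk R k -> sk (d + k)) : continuous f ->
  exists l : disk R k -> sk k,
    continuous l /\ forall x y, j (d + k) (f x) = j k y -> l x = y.
Proof.
have [jc ji _] := mcw_colimit Y.
elim: d f => [|d IHd] f cf.
  by exists f; split=> // x y; exact: skel_in_inj.
have [l1 [cl1 l1E]] := push_off_cells (mcw_pushout Y (d + k)) (leq_addl d k) cf.
have [l [cl lE]] := IHd l1 cl1; exists l; split=> // x y xy; apply: lE.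
have [|z _ zE] := colimit_range (mcw_colimit Y) (leq_addl d k) (_ : range (j k) (j k y)).
  by exists y.
rewrite -zE (l1E x z) //; apply: (@skel_in_inj (d + k).+1).
by rewrite [LHS]xy -zE; exact/esym/ji.
Qed.

Hypothesis contractY : equivariant_classifying_space Y.

Lemma disk_to_skel k (F : disk R k -> Y) : continuous F ->
  exists G : disk R k -> sk k,
    continuous G /\ forall x y, F x = j k y -> G x = y.
Proof.
move=> cF; have [m Fm] := compact_in_stage (mcw_colimit Y) skel_incl_inj
  skel_incl_closed skel_closed1 (@disk_compact R k) cF.
have Fm' : range F `<=` range (j (m + k)).
  by move=> y /Fm; exact: (colimit_range (mcw_colimit Y) (leq_addr k m)).
have [l [cl lE]] := colimit_lift (mcw_colimit Y) skel_incl_inj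
  skel_incl_closed cF Fm'.
have [G [cG GE]] := disk_compress cl; exists G; split=> // x y xy.
by apply: GE; rewrite -xy; exact/esym/lE.
Qed.

(** The case of a disk of dimension 0: a point of the complex moves to a vertex. *)
Lemma skel0_inhabited : exists y : sk 0, True.
Proof.
have [c _] := contractY.
have [|G _] := @disk_to_skel 0 (fun=> c); first exact: cst_continuous.
by exists (G (clip 0)).
Qed.

(** Fill the sphere in the contractible complex, then compress the filling. *)
Lemma skel_sphere_extension n (g : sphere R n.+1 -> sk n) : continuous g ->
  exists G : disk R n.+1 -> sk n.+1,
    continuous G /\ forall s, G (sphere_disk s) = inc n (g s).
Proof.
move=> cg; have [jc ji _] := mcw_colimit Y.
have [F [cF FE]] := sphere_extension contractY (comp_continuous cg (jc n).2.1).
have [G [cG GE]] := disk_to_skel cF; exists G; split=> // s.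
by apply: GE; rewrite FE; exact/esym/ji.
Qed.

End Skeleta.

(** * Equivariant lifting from projective complexes *)

Section ProjectiveLift.
Variables (M : monoidType) (P : mset M) (G : Type) (actG : M -> G -> G).
Variable good : P -> G -> Prop.
Hypothesis actGP : left_action actG.
Hypothesis good_act : forall a q h, good q h -> good (msetact a q) (actG a h).
Hypothesis good_ex : forall q, exists h, good q h.

Let pairs : choiceType := {classic {qh : P * G | good qh.1 qh.2}}.

Let pairs_act (a : M) (z : pairs) : pairs :=
  exist (fun qh : P * G => good qh.1 qh.2)
    (msetact a (sval z).1, actG a (sval z).2) (good_act a (svalP z)).

Let pairs_actP : left_action pairs_act.
Proof.
split=> [[[q h] qh]|a b [[q h] qh]]; apply: eq_exist => /=.
  by rewrite (@msetactP M P).1 actGP.1.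
by rewrite (@msetactP M P).2 actGP.2.
Qed.

(** Solutions of an equivariant family of problems indexed by a projective M-set can
    be chosen equivariantly: the pairs of an index and a solution form an M-set over [P],
    and a section exists. *)
Lemma projective_lift : projective_mset P ->
  exists s : P -> G, (forall q, good q (s q)) /\
    forall a q, s (msetact a q) = actG a (s q).
Proof.
move=> /(_ (MSet pairs_actP) (fun z => (sval z).1)) [].
- by [].
- by move=> q; have [h qh] := good_ex q; exists (exist _ (q, h) qh).
move=> s [sM sq]; exists (fun q => (sval (s q)).2); split=> [q|a q].
  by have := svalP (s q); rewrite sq.
by rewrite sM.
Qed.
End ProjectiveLift.

Lemma discrete_prod_continuous (P : choiceType) (T U : topologicalType)
    (f : P -> T -> U) : (forall q, continuous (f q)) ->
  continuous (fun z : discrete_topology P * T => f z.1 z.2).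
Proof.
move=> cf [q x] W /= /(cf q x) nW; exists ([set q], f q @^-1` W).
  by split=> //=; exact: discrete_set1.
by move=> [q' x'] [/= -> ].
Qed.

Section CellLift.
Variables (R : realType) (M : monoidType) (n : nat) (P : mset M).
Variables (E E' B : mspace M) (e : E -> E') (p : E -> B) (p' : E' -> B).
Hypothesis eM : mspace_map e.
Hypothesis p'M : mspace_map p'.
Hypothesis lifts : forall (g : sphere R n.+1 -> E) (G : disk R n.+1 -> B),
  continuous g -> continuous G -> (forall s, G (sphere_disk s) = p (g s)) ->
  exists G' : disk R n.+1 -> E',
    [/\ continuous G', forall s, G' (sphere_disk s) = e (g s)
      & forall x, p' (G' x) = G x].

Let PS := prod_mspace (discrete_mspace P) (trivial_mspace M (sphere R n.+1)).
Let PD := prod_mspace (discrete_mspace P) (trivial_mspace M (disk R n.+1)).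

(** The index of the problem is the cell; a solution is a map on the
    closed disk. *)
Lemma cell_lift (g : PS -> E) (G : PD -> B) : projective_mset P ->
  mspace_map g -> mspace_map G ->
  (forall q s, G (q, sphere_disk s) = p (g (q, s))) ->
  exists G' : PD -> E',
    [/\ mspace_map G', forall q s, G' (q, sphere_disk s) = e (g (q, s))
      & forall z, p' (G' z) = G z].
Proof.
move=> projP [cg gM] [cG GM] Gg.
have cpair (T : topologicalType) (q : P) :
    continuous (fun x : T => (q, x) : discrete_topology P * T).
  by apply: pair_continuous; [exact: cst_continuous|move=> x; exact: cvg_id].
pose good (q : P) (h : disk R n.+1 -> E') :=
  [/\ continuous h, forall s, h (sphere_disk s) = e (g (q, s))
    & forall x, p' (h x) = G (q, x)].
have [|||s [sgood sM]] := @projective_lift M P _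
    (fun a (h : disk R n.+1 -> E') x => mact a (h x)) good _ _ _ projP.
- split=> [h|a b h]; apply/funext => x; first exact: (@mactP M E').1.
  exact: (@mactP M E').2.
- move=> a q h [ch hs hG]; split=> [|t|x].
  + exact: (comp_continuous ch (@mact_cont M E' a)).
  + by rewrite hs -eM.2 -gM.
  + by rewrite p'M.2 hG -GM.
- move=> q; apply: lifts.
  + exact: (comp_continuous (cpair _ q) cg).
  + exact: (comp_continuous (cpair _ q) cG).
  + by move=> t; rewrite Gg.
exists (fun z => s z.1 z.2); split.
- split; last by move=> a z /=; rewrite sM.
  by apply: (@discrete_prod_continuous P (disk R n.+1) E') => q; have [] := sgood q.
- by move=> q t /=; have [_ ->] := sgood q.
- by case=> q x /=; have [_ _ ->] := sgood q.
Qed.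

End CellLift.

Section ComplexLift.
Variables (R : realType) (M : monoidType) (X : projective_mcw R M).
Variables (E : nat -> mspace M) (e : forall n, E n -> E n.+1) (B : mspace M).
Variables (p : forall n, E n -> B) (phi : X -> B).
Arguments e : clear implicits.
Arguments p : clear implicits.
Hypothesis eM : forall n, mspace_map (e n).
Hypothesis pM : forall n, mspace_map (p n).
Hypothesis pe : forall n z, p n.+1 (e n z) = p n z.
Hypothesis phiM : mspace_map phi.
Hypothesis lifts0 : forall b, exists z, p 0 z = b.
Hypothesis lifts : forall n (g : sphere R n.+1 -> E n) (G : disk R n.+1 -> B),
  continuous g -> continuous G -> (forall s, G (sphere_disk s) = p n (g s)) ->
  exists G' : disk R n.+1 -> E n.+1,
    [/\ continuous G', forall s, G' (sphere_disk s) = e n (g s)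
      & forall x, p n.+1 (G' x) = G x].

Lemma comp_mspace_map (X1 X2 X3 : mspace M) (f : X1 -> X2) (g : X2 -> X3) :
  mspace_map f -> mspace_map g -> mspace_map (fun x => g (f x)).
Proof.
move=> [cf fM] [cg gM]; split; first exact: comp_continuous cf cg.
by move=> a x; rewrite fM gM.
Qed.

Let jM n : mspace_map (@mcw_skel_in _ _ X n).
Proof. by have [/(_ n) []] := mcw_colimit X. Qed.

Let stage n (f : mcw_skel X n -> E n) :=
  mspace_map f /\ forall x, p n (f x) = phi (mcw_skel_in x).

Lemma lift_stage0 : exists f, stage (n := 0) f.
Proof.
have [[cc cM] [c' [[cc' c'M] cK c'K]]] := mcw_skel0 X.
pose good (q : mcw_cells X 0) (z : E 0) :=
  p 0 z = phi (mcw_skel_in (mcw_char0 (p := X) q)).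
have [||||s [sgood sM]] := @projective_lift M (mcw_cells X 0) (E 0)
    (@mact M (E 0)) good.
- exact: mactP.
- move=> a q z qz; rewrite /good (pM 0).2 qz -phiM.2 -(jM 0).2; congr (phi _).
  by congr mcw_skel_in; exact/esym/(cM a q).
- by move=> q; exact: lifts0.
- exact: mcw_projective.
exists (fun x => s (c' x)); split; last first.
  by move=> x; rewrite sgood c'K.
split; last by move=> a x; rewrite c'M sM.
apply: (comp_continuous cc') => q W /nbhs_singleton Wq.
by apply/principal_filterP.
Qed.

Lemma lift_stageS n (f : mcw_skel X n -> E n) : stage f ->
  exists f' : mcw_skel X n.+1 -> E n.+1,
    stage f' /\ forall x, f' (mcw_incl x) = e n (f x).
Proof.
move=> [fM fE]; have po := mcw_pushout X n.
have [[attM _ incM chrM] comm univ] := po.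
have [_ ji _] := mcw_colimit X.
have [|||||G' [G'M G'e G'p]] := cell_lift (e := e n) (p := p n) (p' := p n.+1) (n := n)
    _ _ (@lifts n) (g := fun z => f (mcw_attach z))
    (G := fun z => phi (mcw_skel_in (mcw_char z))) (@mcw_projective _ _ X n.+1).
- exact: eM.
- exact: pM.
- exact: comp_mspace_map attM fM.
- exact: comp_mspace_map (comp_mspace_map chrM (jM n.+1)) phiM.
- move=> q s; rewrite fE; congr phi; rewrite -[RHS]ji; congr mcw_skel_in.
  exact: (esym (comm (q, s))).
have [||x|f' [[f'M f'i f'c] _]] := univ (E n.+1) (fun x => e n (f x)) G'.
- exact: comp_mspace_map fM (eM n).
- exact: G'M.
- by case: x => q s; rewrite G'e.
exists f'; split=> //; split=> // x.
have : (fun x => p n.+1 (f' x)) = (fun x => phi (mcw_skel_in x)).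
  apply: (pushout_top_uniq po).
  - exact: comp_continuous f'M.1 (pM n.+1).1.
  - exact: comp_continuous (jM n.+1).1 phiM.1.
  - by move=> y; rewrite f'i pe fE ji.
  - by move=> z; rewrite f'c G'p.
by move=> /(congr1 (fun h => h x)).
Qed.

(** The lifting principle.  The space [E n] that receives the n-skeleton may depend
    on [n]: with [E n] the n-skeleton of a second complex this yields cellular
    maps, with a constant family it yields ordinary lifts. *)
Lemma complex_lift : exists F : forall n, mcw_skel X n -> E n,
  [/\ forall n, mspace_map (F n),
      forall n x, F n.+1 (mcw_incl x) = e n (F n x)
    & forall n x, p n (F n x) = phi (mcw_skel_in x)].
Proof.
have [f0 f0P] := lift_stage0.
pose next n (f : {f | stage (n := n) f}) : {f | stage (n := n.+1) f} :=
  let c := cid (lift_stageS (svalP f)) in exist _ (sval c) (svalP c).1.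
pose F := nat_rect (fun n => {f | stage (n := n) f}) (exist _ f0 f0P) next.
exists (fun n => sval (F n)); split=> [n|n x|n x].
- exact: (svalP (F n)).1.
- exact: (svalP (cid (lift_stageS (svalP (F n))))).2.
- exact: (svalP (F n)).2.
Qed.

End ComplexLift.

(** * Homotopies as lifts to the path space *)

Section UnitInterval.
Variable R : realType.

Lemma unit_interval_compact : compact [set: unit_interval R].
Proof. by apply: compact_set_type; exact: segment_compact. Qed.

Lemma unit_interval_hausdorff : hausdorff_space (unit_interval R).
Proof. by apply: set_type_hausdorff; exact: Rhausdorff. Qed.

Lemma unit_interval_locally_compact : locally_compact [set: unit_interval R].
Proof.
move=> t _; exists setT; first by rewrite withinET; exact: filterT.
by split; [exact: unit_interval_compact|exact: closedT].
Qed.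

Lemma homotopy_continuous (U W : topologicalType)
    (f : U -> {compact-open, unit_interval R -> W}) :
  continuous f -> (forall u, continuous (f u)) ->
  continuous (fun z : U * unit_interval R => f z.1 z.2).
Proof.
move=> cf cfu.
have -> : (fun z : U * unit_interval R => f z.1 z.2) = uncurry f.
  by apply/funext => -[u t].
exact: continuous_uncurry unit_interval_locally_compact unit_interval_hausdorff _ _.
Qed.

End UnitInterval.

Section PathSpace.
Variables (R : realType) (M : monoidType) (Z : mspace M).

Definition is_path : set {compact-open, unit_interval R -> Z} :=
  [set h | continuous (h : unit_interval R -> Z)].

(** The compact-open topology lives on all functions, continuous or not; the
    exponential law needs the subspace of continuous ones. *)
Definition paths : topologicalType := Topological.clone (set_type is_path) _.

Lemma pathP (h : paths) : continuous (\val h : unit_interval R -> Z).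
Proof. exact: (set_valP h). Qed.

Lemma paths_act_subproof (a : M) (h : paths) :
  ((fun t => mact a (\val h t)) : {compact-open, unit_interval R -> Z}) \in is_path.
Proof.
apply/mem_set.
apply: (@comp_continuous (unit_interval R) Z Z (\val h) (mact a)).
  exact: pathP.
exact: mact_cont.
Qed.

Definition paths_act (a : M) (h : paths) : paths :=
  exist (fun h' => h' \in is_path) _ (paths_act_subproof a h).

Lemma paths_actP : left_action paths_act.
Proof.
split=> [h|a b h]; apply/val_inj/funext => t /=; first exact: (@mactP M Z).1.
exact: (@mactP M Z).2.
Qed.

Lemma paths_act_continuous : continuous_action paths_act.
Proof.
apply: continuous_actionP => a; apply: set_type_continuousP.
move=> h.
have FF : Filter ((fun x : paths => \val (paths_act a x)) @ nbhs h).
  by apply: fmap_filter; exact: nbhs_filter.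
apply/(@compact_open_cvgP _ _ _ _ FF) => K O cK oO aO.
have oaO : open (mact a @^-1` O).
  exact: (preimage_open (@mact_cont M Z a) oO).
have no : nbhs (\val h : {compact-open, unit_interval R -> Z})
    [set g | g @` K `<=` mact a @^-1` O].
  apply: open_nbhs_nbhs; split; first exact: compact_open_open.
  by move=> _ [t Kt <-] /=; apply: aO; exists t.
have nh : nbhs h [set x : paths | (\val x) @` K `<=` mact a @^-1` O].
  exact: (@set_type_val_continuous _ is_path h _ no).
change (nbhs h [set x : paths | (\val (paths_act a x)) @` K `<=` O]).
by apply: filterS nh => g gK _ [t Kt <-]; apply: gK; exists t.
Qed.

Definition path_mspace : mspace M := MSpace paths_actP paths_act_continuous.

Lemma path_eval_continuous t : continuous (fun h : paths => \val h t).
Proof.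
move=> h U; rewrite nbhsE => -[O [oO Oh] OU].
have no : nbhs (\val h : {compact-open, unit_interval R -> Z})
    [set g | g @` [set t] `<=` O].
  apply: open_nbhs_nbhs; split; last by move=> _ [_ -> <-].
  by apply: compact_open_open => //; exact: compact_set1.
have nh : nbhs h [set x : paths | (\val x) @` [set t] `<=` O].
  exact: (@set_type_val_continuous _ is_path h _ no).
change (nbhs h [set x : paths | U (\val x t)]).
by apply: filterS nh => g gO; apply/OU/gO; exists t.
Qed.

Definition path_ends (h : path_mspace) : prod_mspace Z Z :=
  (\val h (I0 R), \val h (I1 R)).

Lemma path_ends_map : mspace_map path_ends.
Proof.
by split=> //; apply: pair_continuous; exact: path_eval_continuous.
Qed.

Hypothesis contractZ : contractible R Z.

Lemma path_lift0 (b : prod_mspace Z Z) : exists h, path_ends h = b.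
Proof.
case: b => u v; have [h [ch h0 h1]] := path_join contractZ u v.
by exists (exist _ h (mem_set ch)); rewrite /path_ends /= h0 h1.
Qed.

(** By the exponential law, lifting a family of endpoints over a disk to paths that are
    prescribed on the sphere is the extension problem of [path_extension]. *)
Lemma path_lift n (g : sphere R n.+1 -> path_mspace)
    (G : disk R n.+1 -> prod_mspace Z Z) :
  continuous g -> continuous G -> (forall s, G (sphere_disk s) = path_ends (g s)) ->
  exists G' : disk R n.+1 -> path_mspace,
    [/\ continuous G', forall s, G' (sphere_disk s) = g s
      & forall x, path_ends (G' x) = G x].
Proof.
move=> cg cG Gg.
have cgamma : continuous (fun z : sphere R n.+1 * unit_interval R => \val (g z.1) z.2).
  apply: (@homotopy_continuous R _ Z (fun s => \val (g s))).
    exact: (comp_continuous cg (@set_type_val_continuous _ is_path)).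
  by move=> s; exact: pathP.
have [||s|s|H [cH H0 H1 Hs]] := path_extension contractZ
  (u := fun x => (G x).1) (v := fun x => (G x).2) _ _ cgamma.
- exact: (comp_continuous cG (@fst_continuous _ _)).
- exact: (comp_continuous cG (@snd_continuous _ _)).
- by rewrite Gg.
- by rewrite Gg.
have [cc cp] := continuous_curry cH.
exists (fun x => exist _ (curry H x) (mem_set (cp x)) : path_mspace); split.
- exact: set_type_continuousP.
- by move=> s; apply/val_inj/funext => t /=; rewrite /curry Hs.
- by move=> x; rewrite /path_ends /= /curry H0 H1; case: (G x).
Qed.

(** A homotopy is a lift of [(u, v)] along the endpoints map of the path space. *)
Lemma maps_to_contractible_homotopic (X : projective_mcw R M) (u v : X -> Z) :
  mspace_map u -> mspace_map v -> mhomotopic R u v.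
Proof.
move=> uM vM; pose phi x : prod_mspace Z Z := (u x, v x).
have phiM : mspace_map phi.
  split; first exact: (pair_continuous uM.1 vM.1).
  by move=> a x; rewrite /phi uM.2 vM.2.
have idM : mspace_map (idfun : path_mspace -> path_mspace).
  by split=> // h; exact: cvg_id.
have [F [FM Fi Fp]] := complex_lift (X := X) (E := fun=> path_mspace)
  (e := fun=> idfun) (p := fun=> path_ends) (fun=> idM) (fun=> path_ends_map)
  (fun _ _ => erefl) phiM path_lift0 path_lift.
have [_ _ univ] := mcw_colimit X.
have [//|F' [[F'M F'E] _]] := univ path_mspace F FM.
have endsE : (fun x => path_ends (F' x)) = phi.
  apply: (colimit_top_uniq (mcw_colimit X)).
  - exact: comp_continuous F'M.1 path_ends_map.1.
  - exact: phiM.1.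
  - by move=> n x; rewrite F'E Fp.
exists (fun z => \val (F' z.1) z.2); split=> [|x|x].
- split; last by move=> a [x t] /=; rewrite F'M.2.
  apply: (@homotopy_continuous R _ Z (fun x => \val (F' x))).
    exact: (comp_continuous F'M.1 (@set_type_val_continuous _ is_path)).
  by move=> x; exact: pathP.
- by have /(congr1 fst) := congr1 (fun f => f x) endsE.
- by have /(congr1 snd) := congr1 (fun f => f x) endsE.
Qed.

End PathSpace.

(** * Existence of cellular maps and the comparison theorem *)

Lemma cellular_map_exists (R : realType) (M : monoidType) (X Y : projective_mcw R M) :
  equivariant_classifying_space Y ->
  exists f : X -> Y, mspace_map f /\ cellular f.
Proof.
move=> hY; pose pt := trivial_mspace M (discrete_topology unit).
have ptM (Z : mspace M) : mspace_map (fun _ : Z => tt : pt).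
  by split=> //; exact: cst_continuous.
have [_ ji _] := mcw_colimit Y.
have jM n : mspace_map (@mcw_skel_in _ _ Y n) by have [/(_ n) []] := mcw_colimit Y.
have [||||||F [FM Fi _]] := complex_lift (X := X) (E := mcw_skel Y)
  (e := @mcw_incl _ _ Y) (B := pt) (p := fun _ _ => tt) (phi := fun=> tt).
- by move=> n; have [/(_ n) []] := mcw_colimit Y.
- by move=> n; exact: ptM.
- by [].
- exact: ptM.
- by case; have [y _] := skel0_inhabited hY; exists y.
- move=> n g G cg _ _; have [G' [cG' G'E]] := skel_sphere_extension hY cg.
  by exists G'; split=> // x; case: (G x).
have [_ _ univ] := mcw_colimit X.
have [||f [[fM fE] _]] := univ Y (fun n x => mcw_skel_in (F n x)).
- by move=> n; exact: comp_mspace_map (FM n) (jM n).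
- by move=> n x; rewrite Fi ji.
exists f; split=> // n _ [_ [x _ <-] <-].
by exists (F n x) => //; rewrite fE.
Qed.

Theorem theorem6p3 (R : realType) (M : monoidType) (X Y : projective_mcw R M)
    (hX : equivariant_classifying_space X)
    (hY : equivariant_classifying_space Y) :
  exists f : X -> Y, mhomotopy_equivalence R f /\ cellular f.
Proof.
have [f [fM fcell]] := cellular_map_exists X hY.
have [g [gM _]] := cellular_map_exists Y hX.
exists f; split=> //; split=> //; exists g; split=> //.
- apply: maps_to_contractible_homotopic => //; first exact: comp_mspace_map fM gM.
  by split=> // x; exact: cvg_id.
- apply: maps_to_contractible_homotopic => //; first exact: comp_mspace_map gM fM.
  by split=> // x; exact: cvg_id.
Qed.
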